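(* Let $H$ be a monoid with quotient monoid $G$ and let $r$ be a finitary ideal system on $H$. The following are equivalent: (1) $H$ is an $r$-almost Dedekind $r$-SP-monoid (i.e. both $r$-almost Dedekind and an $r$-SP-monoid). (2) $H$ is $r$-treed and every nontrivial prime $r$-ideal of $H$ contains an $r$-invertible radical $r$-ideal of $H$. (3) $H$ satisfies the $r$-prime power condition, $H$ is primary $r$-ideal inclusive, and each nontrivial prime $r$-ideal of $H$ contains an $r$-invertible radical $r$-ideal of $H$. (4) The radical of every nontrivial $r$-finitely generated $r$-ideal of $H$ is $r$-invertible. (5) $\mathcal{P}(I)\subseteq\mathfrak{X}(H)$ for every nontrivial $r$-finitely generated $r$-ideal $I$ of $H$, and the radical of every nontrivial principal ideal of $H$ is $r$-invertible.
   Context: Monoids. A monoid $H$ is a commutative semigroup with identity and more than one element in which every nonzero element is cancellative. Here $z(H)=\{z\in H: zx=z \text{ for all } x\in H\}$ is the set of zero elements ($|z(H)|\le 1$, possibly empty); ''nonzero'' means not in $z(H)$; $H^{\bullet}=H\setminus z(H)$; $H^{\times}$ is the unit group; $G=(H^{\bullet})^{-1}H$ is the quotient monoid; $\mathbb{N}$ is the set of positive integers. For $X\subseteq H$, $\sqrt X=\{x\in H: x^n\in X\text{ for some }n\in\mathbb{N}\}$; for $Y\subseteq G$, $Y^{-1}=\{z\in G: zY\subseteq H\}$. Ideals. $X\subseteq H$ is an $s$-ideal if $X=XH\cup z(H)$; it is radical if $\sqrt X=X$; nontrivial if $z(H)\subsetneq X$; proper if $X\ne H$. A principal ideal is a set $AH\cup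 z(H)$ with $A\subseteq H$, $|A|\le 1$. A prime $s$-ideal is a proper $s$-ideal $P$ such that $xy\in P$ implies $x\in P$ or $y\in P$; a proper $s$-ideal $I$ is primary if $xy\in I$, $x\notin I$ imply $y\in\sqrt I$. $\mathfrak{X}(H)$ is the set of minimal elements among the prime $s$-ideals properly containing $z(H)$; $\mathcal{P}(X)$ is the set of prime $s$-ideals minimal above $X$. For a prime $s$-ideal $P$, $H_P=(H\setminus P)^{-1}H$. Ideal systems. A finitary ideal system on $H$ is a map $r:\mathbb{P}(H)\to\mathbb{P}(H)$, $X\mapsto X_r$ ($\mathbb{P}$ = power set) such that for all $X,Y\subseteq H$, $c\in H$: $XH\cup z(H)\subseteq X_r$; $X\subseteq Y_r$ implies $X_r\subseteq Y_r$; $cX_r=(cX)_r$; $X_r=\bigcup_{E\subseteq X,|E|<\infty}E_r$. An $r$-ideal is an $X\subseteq H$ with $X_r=X$; it is $r$-invertible if $(XX^{-1})_r=H$; an $r$-ideal $I$ is $r$-finitely generated if $I=E_r$ for some finite $E\subseteq I$. Prime/primary $r$-ideals are $r$-ideals that are prime/primary $s$-ideals. The $r$-product of $r$-ideals $I,J$ is $(IJ)_r$ (similarly for finitely many factors), and $r$-powers are $(I^k)_r$, $k\in\mathbb{N}$. $r$-$\max(H)$ is the set of maximal elements among the proper $r$-ideals. Properties. If $H\neq G$, $H$ is a DVM (discrete valuation monoid) if every $s$-ideal of $H$ is principal (equivalently, every prime $s$-ideal is principal). $H$ is $r$-almost Dedekind if $H=G$ or $H_M$ is a DVM for each $M\in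 r$-$\max(H)$. $H$ is an $r$-SP-monoid if every $r$-ideal of $H$ is a finite $r$-product of radical $r$-ideals. $H$ is $r$-treed if for all $M\in r$-$\max(H)$ the prime $r$-ideals contained in $M$ form a chain. $H$ satisfies the $r$-prime power condition if every primary $r$-ideal of $H$ is an $r$-power of its radical. $H$ is primary $r$-ideal inclusive if for all prime $r$-ideals $P\subsetneq Q$ there is a primary $r$-ideal $I$ with $P\subseteq I\subsetneq\sqrt I\subseteq Q$. *)

(* Defs.v *)
From mathcomp Require Import all_boot all_classical.

Set Implicit Arguments.
Unset Strict Implicit.
Unset Printing Implicit Defensive.

Local Open Scope classical_set_scope.
Local Open Scope group_scope.

(* A monoid H, all its ideals and all its localizations H_P are subsets of an
   ambient commutative monoid G, in which the quotient monoid of H is taken;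
   P(H) is the collection of the X : set G with X `<=` H. *)

Definition setmul (G : monoidType) (X Y : set G) : set G :=
  [set x * y | x in X & y in Y].

Definition setprod (G : monoidType) (s : seq (set G)) : set G :=
  foldr (@setmul G) [set 1] s.

Definition zeros (G : monoidType) (H : set G) : set G :=
  [set z | H z /\ forall x, H x -> z * x = z].

Definition nonzero (G : monoidType) (H : set G) : set G := H `\` zeros H.

Record is_monoid (G : monoidType) (H : set G) : Prop := IsMonoid {
  is_monoid1 : H 1;
  is_monoidM : forall x y, H x -> H y -> H (x * y);
  is_monoidC : forall x y, H x -> H y -> x * y = y * x;
  is_monoid_gt1 : exists x y, [/\ H x, H y & x <> y];
  is_monoid_cancel : forall x, nonzero H x ->
    forall y z, H y -> H z -> x * y = x * z -> y = z }.

(* S^-1 H: when the elements of S are invertible in the ambient monoid,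
   g * s = x says that g is the fraction x / s. *)
Definition fractions (G : monoidType) (H S : set G) : set G :=
  [set g | exists x s, [/\ H x, S s & g * s = x]].

Definition quotient (G : monoidType) (H : set G) : set G :=
  fractions H (nonzero H).

(* The whole of G is the quotient monoid of H; as H is contained in G, these
   conditions determine G up to a unique isomorphism over H. *)
Record is_quotient_monoid (G : monoidType) (H : set G) : Prop :=
  IsQuotientMonoid {
  quotient_monoidC : commutative (@mul G);
  quotient_monoid_inv : forall s, nonzero H s -> exists t, s * t = 1;
  quotient_monoid_frac : quotient H = setT }.

Definition radical (G : monoidType) (H X : set G) : set G :=
  [set x | H x /\ exists2 n : nat, (0 < n)%N & X (x ^+ n)].

(* X^-1 = (H : X) in G *)
Definition inverse_ideal (G : monoidType) (H X : set G) : set G :=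
  [set g | setmul [set g] X `<=` H].

Definition minimal_elements (G : monoidType) (F : set (set G)) :
    set (set G) :=
  [set X | F X /\ forall Y, F Y -> Y `<=` X -> Y = X].

Definition maximal_elements (G : monoidType) (F : set (set G)) :
    set (set G) :=
  [set X | F X /\ forall Y, F Y -> X `<=` Y -> Y = X].

Definition s_ideal (G : monoidType) (H X : set G) : Prop :=
  X `<=` H /\ X = setmul X H `|` zeros H.

Definition nontrivial (G : monoidType) (H X : set G) : Prop :=
  zeros H `<` X.

(* The generating set A may be empty, so that zeros H is principal. *)
Definition principal_ideal (G : monoidType) (H X : set G) : Prop :=
  exists A : set G,
    [/\ A `<=` H, is_subset1 A & X = setmul A H `|` zeros H].

Definition prime_s_ideal (G : monoidType) (H P : set G) : Prop :=
  [/\ s_ideal H P, P <> H &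
      forall x y, H x -> H y -> P (x * y) -> P x \/ P y].

Definition primary_s_ideal (G : monoidType) (H I : set G) : Prop :=
  [/\ s_ideal H I, I <> H &
      forall x y, H x -> H y -> I (x * y) -> ~ I x -> radical H I y].

Definition height_one_primes (G : monoidType) (H : set G) : set (set G) :=
  minimal_elements [set P | prime_s_ideal H P /\ zeros H `<` P].

Definition minimal_primes (G : monoidType) (H X : set G) : set (set G) :=
  minimal_elements [set P | prime_s_ideal H P /\ X `<=` P].

Definition localization (G : monoidType) (H P : set G) : set G :=
  fractions H (H `\` P).

Definition is_dvm (G : monoidType) (K : set G) : Prop :=
  K <> quotient K /\ forall X, s_ideal K X -> principal_ideal K X.

(* Only the values of r on subsets of H are constrained, and only these are
   ever used. *)
Record finitary_ideal_system (G : monoidType) (H : set G)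
    (r : set G -> set G) : Prop := FinitaryIdealSystem {
  ideal_system_sub : forall X, X `<=` H -> r X `<=` H;
  ideal_system_ext : forall X, X `<=` H -> setmul X H `|` zeros H `<=` r X;
  ideal_system_hull : forall X Y, X `<=` H -> Y `<=` H ->
    X `<=` r Y -> r X `<=` r Y;
  ideal_system_mul : forall c X, H c -> X `<=` H ->
    setmul [set c] (r X) = r (setmul [set c] X);
  ideal_system_fin : forall X, X `<=` H ->
    r X = \bigcup_(E in [set E | E `<=` X /\ finite_set E]) r E }.

Definition r_ideal (G : monoidType) (H : set G) (r : set G -> set G)
    (X : set G) : Prop :=
  X `<=` H /\ r X = X.

Definition radical_r_ideal (G : monoidType) (H : set G)
    (r : set G -> set G) (X : set G) : Prop :=
  r_ideal H r X /\ radical H X = X.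

Definition prime_r_ideal (G : monoidType) (H : set G)
    (r : set G -> set G) (P : set G) : Prop :=
  r_ideal H r P /\ prime_s_ideal H P.

Definition primary_r_ideal (G : monoidType) (H : set G)
    (r : set G -> set G) (I : set G) : Prop :=
  r_ideal H r I /\ primary_s_ideal H I.

Definition r_invertible (G : monoidType) (H : set G)
    (r : set G -> set G) (X : set G) : Prop :=
  r_ideal H r X /\ r (setmul X (inverse_ideal H X)) = H.

Definition r_finitely_generated (G : monoidType) (H : set G)
    (r : set G -> set G) (I : set G) : Prop :=
  r_ideal H r I /\ exists E, [/\ finite_set E, E `<=` I & I = r E].

Definition r_max (G : monoidType) (H : set G) (r : set G -> set G) :
    set (set G) :=
  maximal_elements [set I | r_ideal H r I /\ I <> H].

Definition r_almost_dedekind (G : monoidType) (H : set G)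
    (r : set G -> set G) : Prop :=
  H = quotient H \/ forall M, r_max H r M -> is_dvm (localization H M).

(* Since r [set 1] = H is itself a radical r-ideal, it is harmless to admit the
   empty product. *)
Definition r_SP_monoid (G : monoidType) (H : set G)
    (r : set G -> set G) : Prop :=
  forall I, r_ideal H r I ->
    exists s : seq (set G),
      (forall i, (i < size s)%N -> radical_r_ideal H r (nth set0 s i)) /\
      I = r (setprod s).

Definition r_treed (G : monoidType) (H : set G)
    (r : set G -> set G) : Prop :=
  forall M, r_max H r M ->
    total_on [set P | prime_r_ideal H r P /\ P `<=` M] subset.

Definition r_prime_power_condition (G : monoidType) (H : set G)
    (r : set G -> set G) : Prop :=
  forall I, primary_r_ideal H r I ->
    exists2 k : nat, (0 < k)%N & I = r (setprod (nseq k (radical H I))).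

Definition primary_r_ideal_inclusive (G : monoidType) (H : set G)
    (r : set G -> set G) : Prop :=
  forall P Q, prime_r_ideal H r P -> prime_r_ideal H r Q -> P `<` Q ->
    exists I, [/\ primary_r_ideal H r I, P `<=` I, I `<` radical H I &
                  radical H I `<=` Q].

Definition primes_contain_invertible_radical (G : monoidType) (H : set G)
    (r : set G -> set G) : Prop :=
  forall P, prime_r_ideal H r P -> nontrivial H P ->
    exists J, [/\ radical_r_ideal H r J, r_invertible H r J & J `<=` P].

(* Main.v *)
Require Import Defs.
From mathcomp Require Import all_boot all_classical.

(** All five conditions are compared with a sixth one: every nontrivial prime
    r-ideal contains an invertible radical r-ideal, and there is no proper
    inclusion between nontrivial prime r-ideals ([dim_one]).

    The first half of the argument is that each condition forces dimension one.
    The reason is mostly [prime_gap]: if a prime [Q] is minimal over an element,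
    then no prime properly inside [Q] contains an invertible radical ideal [J].
    For [J] has a single generator [a] near [Q], a power of [a] is a multiple of
    [x] near [Q], and since [J] is radical the factors [a] can be cancelled one by
    one until [x] divides an element outside [Q].  A chain of primes that is too
    long yields such a [Q]: in a treed monoid a prime minimal over any [x] that
    distinguishes two primes ([dim_one_of_treed]), under condition (3) a prime
    that is not its own square ([dim_one_of_prime_power]).  Under condition (5) a
    divisibility argument with the radicals of [y * H] and [x * y * H] takes its
    place ([dim_one_of_height_one]), and under condition (1) the structure of the
    discrete valuation monoids does ([dvm_prime_eq]).

    The second half is that dimension one gives everything else.  An invertible
    radical ideal inside a nontrivial prime [M] is equal to [M] near [M], so [M]
    has there one generator, and each nonzero element is near [M] a unit times a
    power of it ([valuation]).  Primary ideals are therefore powers of their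
    radicals, the localizations are discrete valuation monoids, and the radical
    of a finitely generated ideal, which is everywhere locally principal, is
    invertible ([radical_invertible_of_dim_one]).  To factor an arbitrary ideal
    [I], split off its radical again and again; that this ends is seen on an
    invertible ideal inside [I], whose local exponents decrease and, by
    compactness of the maximal spectrum, all vanish after finitely many steps
    ([radical_colon_reaches_H], [radical_factor]). *)

Set Implicit Arguments.
Unset Strict Implicit.
Unset Printing Implicit Defensive.

Local Open Scope classical_set_scope.
Local Open Scope group_scope.

(** [mul_ac] proves equalities of products that hold by associativity and
    commutativity: the factors of the right-hand side are, one after the other,
    pulled to the front of the left-hand side. *)
Ltac pull_front C CA t y :=
  match t with
  | y * ?u => constr:(erefl t)
  | ?a * y => constr:(C a y)
  | ?a * ?u =>
      let p := pull_front C CA u y in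
      constr:(etrans (congr1 (mul a) p) (CA a y _))
  end.

Ltac mul_ac C CA :=
  rewrite -?mulgA;
  repeat match goal with
  | |- ?l = ?y * _ =>
      let p := pull_front C CA l y in
      refine (etrans p _); apply: (congr1 (mul y))
  end; reflexivity.

(** * Arithmetic of the monoid *)

Section IdealTheory.

Variables (G : monoidType) (H : set G) (r : set G -> set G).
Hypotheses (monH : is_monoid H) (quotG : is_quotient_monoid H).
Hypothesis sysr : finitary_ideal_system H r.

Implicit Types (x y h s t u g : G) (X Y I J L P Q M : set G) (n k : nat).

Let HM := is_monoidM monH.
Let H1 : H 1 := is_monoid1 monH.
Let C : commutative (@mul G) := quotient_monoidC quotG.

Let CA (x y z : G) : x * (y * z) = y * (x * z).
Proof. by rewrite !mulgA (C x). Qed.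

Local Ltac ac := mul_ac C CA.

Lemma expM x y n : (x * y) ^+ n = x ^+ n * y ^+ n.
Proof. by apply: expgMn; apply: C. Qed.

Lemma expS x n : x ^+ n.+1 = x * x ^+ n.
Proof. exact: expgS. Qed.

Lemma expD x n k : x ^+ (n + k) = x ^+ n * x ^+ k.
Proof. exact: expgnDr. Qed.

Lemma HX x n : H x -> H (x ^+ n).
Proof. by move=> Hx; elim: n => // n IH; rewrite expS; apply: HM. Qed.

Lemma nonzeroH x : nonzero H x -> H x.
Proof. by case. Qed.

Lemma nonzero_inv s : nonzero H s -> exists t, s * t = 1.
Proof. exact: (quotient_monoid_inv quotG). Qed.

Lemma nonzeroI s x y : nonzero H s -> s * x = s * y -> x = y.
Proof.
move=> /nonzero_inv[t st] /(congr1 (mul t)).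
by rewrite !mulgA (C t) st !mul1g.
Qed.

Lemma nonzero1 : nonzero H 1.
Proof.
split=> // -[_ z1]; have [x [y [Hx Hy]]] := is_monoid_gt1 monH; apply.
by rewrite -[x]mul1g -[y]mul1g !z1.
Qed.

Lemma nonzeroM x y : nonzero H x -> nonzero H y -> nonzero H (x * y).
Proof.
move=> nx [Hy ny]; split; first by apply: HM => //; apply: nonzeroH.
move=> [_ zxy]; apply: ny; split=> // w Hw.
by apply: (nonzeroI nx); rewrite mulgA zxy.
Qed.

Lemma nonzeroX x n : nonzero H x -> nonzero H (x ^+ n).
Proof.
by move=> nx; elim: n => [|n IH]; [exact: nonzero1|rewrite expS;
  apply: nonzeroM].
Qed.

Lemma fraction g : exists h s, [/\ H h, nonzero H s & g * s = h].
Proof.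
have : quotient H g by rewrite (quotient_monoid_frac quotG).
by [].
Qed.

Lemma nonzero_divl x g : H x -> nonzero H (x * g) -> nonzero H x.
Proof.
move=> Hx [Hxg nxg]; split=> // -[_ zx].
have [h [s [Hh ns gs]]] := fraction g; apply: nxg; split=> // w Hw.
have Hs := nonzeroH ns; apply: (nonzeroI ns).
have -> : s * (x * g * w) = x * (g * s * w) by ac.
have -> : s * (x * g) = x * (g * s) by ac.
by rewrite gs !zx //; exact: HM.
Qed.

(** * Closure under the ideal system *)

Lemma r_sub X : X `<=` H -> r X `<=` H.
Proof. exact: ideal_system_sub. Qed.

Lemma sub_r X : X `<=` H -> X `<=` r X.
Proof.
move=> XH x Xx; apply: (ideal_system_ext sysr XH); left.
by exists x => //; exists 1; rewrite ?mulg1.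
Qed.

Lemma r_hull X Y : X `<=` H -> r_ideal H r Y -> X `<=` Y -> r X `<=` Y.
Proof.
by move=> XH [YH rY] XY; rewrite -rY; apply: (ideal_system_hull sysr) => //;
  rewrite rY.
Qed.

Lemma r_idem X : X `<=` H -> r_ideal H r (r X).
Proof.
move=> XH; have rH := r_sub XH; split=> //; apply/seteqP; split;
  last exact: sub_r.
exact: (ideal_system_hull sysr).
Qed.

Lemma r_mono X Y : Y `<=` H -> X `<=` Y -> r X `<=` r Y.
Proof.
move=> YH XY; apply: r_hull (r_idem YH) _; first exact: subset_trans YH.
by apply: subset_trans XY _; exact: sub_r.
Qed.

Lemma r_ideal_s_ideal X : r_ideal H r X -> s_ideal H X.
Proof.
move=> [XH rX]; split=> //; apply/seteqP; split=> x.
  by move=> Xx; left; exists x => //; exists 1; rewrite ?mulg1.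
by rewrite -{2}rX; exact: (ideal_system_ext sysr).
Qed.

Lemma s_ideal_sub X x : s_ideal H X -> X x -> H x.
Proof. by move=> [XH _] /XH. Qed.

Lemma s_idealMr X x h : s_ideal H X -> X x -> H h -> X (x * h).
Proof. by move=> [_ eX] Xx Hh; rewrite eX; left; exists x => //; exists h. Qed.

Lemma s_idealMl X x h : s_ideal H X -> X x -> H h -> X (h * x).
Proof. by rewrite C; exact: s_idealMr. Qed.

Lemma s_ideal_zeros X : s_ideal H X -> zeros H `<=` X.
Proof. by move=> [_ eX] x zx; rewrite eX; right. Qed.

Lemma r_idealMr X x h : r_ideal H r X -> X x -> H h -> X (x * h).
Proof. by move/r_ideal_s_ideal; apply: s_idealMr. Qed.

Lemma r_idealMl X x h : r_ideal H r X -> X x -> H h -> X (h * x).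
Proof. by move/r_ideal_s_ideal; apply: s_idealMl. Qed.

Lemma r_ideal_proper X : r_ideal H r X -> X <> H <-> ~ X 1.
Proof.
move=> rX; split=> [XH X1|X1 XH]; last by apply: X1; rewrite XH.
apply: XH; apply/seteqP; split; first by case: rX.
by move=> x Hx; rewrite -[x]mul1g; apply: r_idealMr.
Qed.

Lemma r_idealH : r_ideal H r H.
Proof.
by split=> //; apply/seteqP; split; [exact: r_sub|exact: sub_r].
Qed.

(** The set of the [x] with [g * x] in [Y] is closed under [r], also for a
    fraction [g = h / s]: [h * x] lies in [h * r X = r (s * (g * X))], which is
    [s * r (g * X)], and [s] is cancelled.  Nearly every closure argument below
    is an instance of this. *)
Lemma r_transporter X Y g : X `<=` H -> r_ideal H r Y ->
  (forall x, X x -> Y (g * x)) -> forall x, r X x -> Y (g * x).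
Proof.
move=> XH rY gX x rXx; have [h [s [Hh ns gs]]] := fraction g.
have Hs := nonzeroH ns.
have gXH : setmul [set g] X `<=` H.
  by move=> _ [_ -> [y Xy <-]]; case: rY => + _; apply; exact: gX.
have eqh : setmul [set h] X = setmul [set s] (setmul [set g] X).
  apply/seteqP; split=> w.
    move=> [_ -> [y Xy <-]]; exists s => //; exists (g * y);
      last by rewrite -gs; ac.
    by exists g => //; exists y.
  move=> [_ -> [_ [_ -> [y Xy <-]] <-]]; exists h => //; exists y => //.
  by rewrite -gs; ac.
have : setmul [set h] (r X) (h * x) by exists h => //; exists x.
rewrite (ideal_system_mul sysr) // eqh -(ideal_system_mul sysr) //.
move=> [_ -> [y ry]] sy.
suff -> : g * x = y.
  by move: y ry {sy}; apply: r_hull => // w [_ -> [v Xv <-]]; exact: gX.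
by apply: (nonzeroI ns); rewrite sy -gs; ac.
Qed.

Lemma r_finitary X x : X `<=` H -> r X x ->
  exists2 s : seq G, [set` s] `<=` X & r [set` s] x.
Proof.
move=> XH; rewrite (ideal_system_fin sysr XH) =>
  -[E [EX /finite_seqP[s Es]] rEx].
by exists s; rewrite -Es.
Qed.

(** * Prime ideals and radicals *)

Lemma least_nat (A : nat -> Prop) : (exists n, A n) ->
  exists2 k, A k & forall j, A j -> (k <= j)%N.
Proof.
move=> [n An]; have exA : exists n, `[< A n >] by exists n; apply/asboolP.
case: (ex_minnP exA) => k /asboolP Ak mink; exists k => // j Aj.
by apply: mink; apply/asboolP.
Qed.

Lemma nsubset_witness X Y : ~ X `<=` Y -> exists2 x, X x & ~ Y x.
Proof.
move=> nXY; apply: contrapT => nx; apply: nXY => x Xx.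
by apply: contrapT => nYx; apply: nx; exists x.
Qed.

Lemma disjointN X Y x : X `&` Y = set0 -> X x -> Y x -> False.
Proof. by move=> XY Xx Yx; have : (X `&` Y) x by []; rewrite XY. Qed.

Definition mult_closed (S : set G) :=
  S 1 /\ forall x y, S x -> S y -> S (x * y).

Lemma setmul_sub X Y : X `<=` H -> Y `<=` H -> setmul X Y `<=` H.
Proof. by move=> XH YH _ [x Xx [y Yy <-]]; apply: HM;
  [exact: XH|exact: YH]. Qed.

Lemma r_mul X Y x y : X `<=` H -> Y `<=` H -> r X x -> r Y y ->
  r (setmul X Y) (x * y).
Proof.
move=> XH YH rx ry; have XYH := setmul_sub XH YH.
have rXY := r_idem XYH.
apply: (r_transporter YH rXY) ry => y' Yy'; rewrite C.
apply: (r_transporter XH rXY) rx => x' Xx'; rewrite C.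
by apply: sub_r => //; exists x' => //; exists y'.
Qed.

Lemma r_setmul_sub X Y Z : X `<=` H -> Y `<=` H -> r_ideal H r Z ->
  (forall x y, X x -> Y y -> Z (x * y)) ->
  forall x y, r X x -> r Y y -> Z (x * y).
Proof.
move=> XH YH rZ XYZ x y rx ry;
  apply: r_hull (setmul_sub XH YH) rZ _ _ (r_mul XH YH rx ry).
by move=> _ [a Xa [b Yb <-]]; exact: XYZ.
Qed.

Lemma r_ideal_principal h : H h -> r_ideal H r (setmul [set h] H).
Proof.
move=> Hh; have <- : r (setmul [set h] H) = setmul [set h] H.
  by rewrite -(ideal_system_mul sysr) //; case: r_idealH => _ ->.
by apply: r_idem => _ [_ -> [x Hx <-]]; apply: HM.
Qed.

Lemma principalP h y : setmul [set h] H y <-> exists2 w, H w & y = h * w.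
Proof.
split=> [[_ -> [w Hw <-]]|[w Hw ->]]; first by exists w.
by exists h => //; exists w.
Qed.

Lemma principal_self h : setmul [set h] H h.
Proof. by apply/principalP; exists 1; rewrite ?mulg1. Qed.

Lemma principal_sub X h : s_ideal H X -> X h -> setmul [set h] H `<=` X.
Proof. by move=> sX Xh _ /principalP[w Hw ->]; exact: s_idealMr. Qed.

(** Zorn's lemma applies because a finite subset of the union of a chain lies in
    a member of the chain and [r] is finitary.  The sets [A] to which it is
    applied are the sets by which [I] is enlarged, so that the union of an empty
    chain causes no trouble. *)
Lemma maximal_r_ideal_avoiding (S I : set G) : r_ideal H r I ->
  I `&` S = set0 ->
  exists Q, [/\ r_ideal H r Q, I `<=` Q, Q `&` S = set0 &
    forall Y, r_ideal H r Y -> Q `<=` Y -> Y `&` S = set0 -> Y = Q].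
Proof.
move=> rI IS; have IH := rI.1.
pose F : set (set G) := [set A | A `<=` H /\ r (I `|` A) `&` S = set0].
have IAH A : A `<=` H -> I `|` A `<=` H by move=> AH x [/IH|/AH].
have [|A [[AH AS] maxA]] := Zorn_bigcup (P := F).
  move=> D DF totD.
  have DH : \bigcup_(X in D) X `<=` H by move=> x [X /DF[XH _] Xx]; exact: XH.
  split=> //; rewrite -subset0 => x [+ Sx] =>
    /(r_finitary (IAH _ DH))[s sD rsx].
  have [sI|[X [DX sX]]] :
      [set` s] `<=` I \/ exists X, D X /\ [set` s] `<=` I `|` X.
    elim: s sD {rsx} => [|y s IHs] sD; first by left.
    have ysub : [set` s] `<=` [set` y :: s].
      by move=> z /=; rewrite inE => ->; rewrite orbT.
    have yin : [set` y :: s] y by rewrite /= inE eqxx.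
    have consE Z : Z y -> [set` s] `<=` Z -> [set` y :: s] `<=` Z.
      by move=> Zy sZ z /=; rewrite inE => /orP[/eqP->//|/sZ].
    have [sI|[X [DX sX]]] := IHs (subset_trans ysub sD).
      case: (sD _ yin) => [Iy|[X DX Xy]]; first by left; exact: consE.
      right; exists X; split=> //; apply: consE; first by right.
      by move=> z /sI; left.
    right; case: (sD _ yin) => [Iy|[Y DY Yy]].
      by exists X; split=> //; apply: consE => //; left.
    have [XY|YX] := totD _ _ DX DY.
      exists Y; split=> //; apply: consE; first by right.
      by move=> z /sX[Iz|/XY]; [left|right].
    by exists X; split=> //; apply: consE => //; right; exact: YX.
  - by rewrite -IS; split=> //; exact: (r_hull (subset_trans sI IH) rI sI rsx).
  - have [XH XS] := DF _ DX; rewrite -XS; split=> //.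
    by apply: r_mono rsx => //; exact: IAH.
have rQ := r_idem (IAH _ AH); have IAQ := sub_r (IAH _ AH).
exists (r (I `|` A)); split=> //; first by move=> x Ix; apply: IAQ; left.
move=> Y rY QY YS; apply/seteqP; split=> //.
have AY : A `<=` Y by move=> x Ax; apply: QY; apply: IAQ; right.
have FY : F Y.
  split; first by case: rY.
  rewrite -subset0 => x [rx Sx]; rewrite -YS; split=> //.
  apply: r_hull rx => //; first by apply: IAH; case: rY.
  by move=> z [Iz|//]; apply: QY; apply: IAQ; left.
have YA : Y `<=` A by apply: contrapT => nYA; exact: (maxA _ (conj AY nYA)).
by move=> x /YA Ax; apply: IAQ; right.
Qed.

(** If [x] and [y] lie outside [Q], then by maximality [r (Q, x)] and [r (Q, y)]
    meet [S]; so does their product, which is inside [Q] when [x * y] is. *)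
Lemma maximal_avoiding_prime (S Q : set G) : mult_closed S -> r_ideal H r Q ->
  Q `&` S = set0 ->
  (forall Y, r_ideal H r Y -> Q `<=` Y -> Y `&` S = set0 -> Y = Q) ->
  prime_r_ideal H r Q.
Proof.
move=> [S1 SM] rQ QS maxQ; split=> //; split; first exact: r_ideal_s_ideal.
  by apply/(r_ideal_proper rQ) => Q1; exact: (disjointN QS Q1).
move=> x y Hx Hy Qxy; apply: contrapT => /not_orP[nQx nQy].
have QxH z : H z -> Q `|` [set z] `<=` H by move=> Hz w [/rQ.1|->].
have meet z : H z -> ~ Q z -> exists2 s, r (Q `|` [set z]) s & S s.
  move=> Hz nQz; have Qsub := sub_r (QxH z Hz).
  apply: contrapT => nS; apply: nQz.
  suff <- : r (Q `|` [set z]) = Q by apply: Qsub; right.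
  apply: maxQ.
  - exact: r_idem (QxH z Hz).
  - by move=> w Qw; apply: Qsub; left.
  - by rewrite -subset0 => w [rw Sw]; apply: nS; exists w.
have [s rs Ss] := meet _ Hx nQx; have [t rt St] := meet _ Hy nQy.
apply: (disjointN QS _ (SM _ _ Ss St)).
apply: (r_setmul_sub (QxH x Hx) (QxH y Hy) rQ) rs rt => a b.
move=> [Qa [Qb|->]|-> [Qb|->]] //.
- by apply: r_idealMr => //; exact: rQ.1.
- exact: r_idealMr.
- exact: r_idealMl.
Qed.

Lemma prime_avoiding (S I : set G) : mult_closed S -> r_ideal H r I ->
  I `&` S = set0 ->
  exists Q, [/\ prime_r_ideal H r Q, I `<=` Q & Q `&` S = set0].
Proof.
move=> mS rI /(maximal_r_ideal_avoiding rI)[Q [rQ IQ QS maxQ]].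
by exists Q; split=> //; exact: maximal_avoiding_prime maxQ.
Qed.

Lemma r_max_prime M : r_max H r M -> prime_r_ideal H r M.
Proof.
move=> [[rM MnH] maxM].
have M1 : ~ M 1 by apply/(r_ideal_proper rM).
apply: (maximal_avoiding_prime (S := [set 1])) => //.
- by split=> // x y -> ->; rewrite mulg1.
- by rewrite -subset0 => x [Mx x1]; apply: M1; rewrite -x1.
- move=> Y rY MY Y1; apply: maxM => //; split=> //.
  by apply/(r_ideal_proper rY) => Y1'; exact: (disjointN Y1 Y1').
Qed.

Lemma exists_r_max I : r_ideal H r I -> ~ I 1 ->
  exists2 M, r_max H r M & I `<=` M.
Proof.
move=> rI I1; have I1' : I `&` [set 1] = set0.
  by rewrite -subset0 => x [Ix x1]; apply: I1; rewrite -x1.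
have [Q [rQ IQ QS maxQ]] := maximal_r_ideal_avoiding rI I1'.
exists Q => //; split.
  by split=> //; apply/(r_ideal_proper rQ) => Q1; exact: (disjointN QS Q1).
move=> Y [rY /(r_ideal_proper rY) Y1] QY; apply: maxQ => //.
by rewrite -subset0 => x [Yx x1]; apply: Y1; rewrite -x1.
Qed.

Lemma prime_s_ideal1 P : prime_s_ideal H P -> ~ P 1.
Proof.
move=> [sP PH _] P1; apply: PH; apply/seteqP; split; first by case: sP.
by move=> x Hx; rewrite -[x]mul1g; exact: s_idealMr.
Qed.

Lemma primeN_M P x y : prime_s_ideal H P -> (H `\` P) x -> (H `\` P) y ->
  (H `\` P) (x * y).
Proof.
move=> [_ _ pP] [Hx nx] [Hy ny]; split; first exact: HM.
by case/pP.
Qed.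

Lemma prime_compl P : prime_s_ideal H P -> mult_closed (H `\` P).
Proof.
move=> pP; split; last by move=> x y; exact: primeN_M.
by split=> //; exact: prime_s_ideal1.
Qed.

Lemma primeN_X P x n : prime_s_ideal H P -> (H `\` P) x -> (H `\` P) (x ^+ n).
Proof.
move=> pP Px; have [P1 PM] := prime_compl pP.
by elim: n => // n IH; rewrite expS; exact: PM.
Qed.

Lemma primeNM P x y : prime_s_ideal H P -> (H `\` P) x -> H y ->
  P (x * y) -> P y.
Proof. by move=> [_ _ pP] [Hx nx] Hy /pP[]. Qed.

Lemma primeX P x n : prime_s_ideal H P -> H x -> P (x ^+ n) -> P x.
Proof.
move=> pP Hx; apply: contraPP => nPx.
by have [] := primeN_X n pP (conj Hx nPx).
Qed.

Lemma prime_nonzero P x : prime_s_ideal H P -> (H `\` P) x -> nonzero H x.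
Proof. by move=> [sP _ _] [Hx nx]; split=> // /(s_ideal_zeros sP). Qed.

Lemma radical_prime_sub P I : prime_s_ideal H P -> I `<=` P ->
  radical H I `<=` P.
Proof. by move=> pP IP x [Hx [n _ Ixn]]; apply: primeX (IP _ Ixn). Qed.

Lemma radical_sub I : radical H I `<=` H.
Proof. by move=> x []. Qed.

Lemma sub_radical I : I `<=` H -> I `<=` radical H I.
Proof. by move=> IH x Ix; split; [exact: IH|exists 1%N]. Qed.

Lemma radical_mono I J : I `<=` J -> radical H I `<=` radical H J.
Proof. by move=> IJ x [Hx [n n0 Ixn]]; split=> //; exists n => //;
  exact: IJ. Qed.

Lemma radical_idem I : radical H (radical H I) = radical H I.
Proof.
apply/seteqP; split; last exact: sub_radical (@radical_sub I).
move=> x [Hx [n n0 [_ [m m0]]]]; rewrite -expgnA => Ix; split=> //.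
by exists (n * m)%N => //; rewrite muln_gt0 n0.
Qed.

(** The radical is an intersection of prime r-ideals: an element outside it
    spans a multiplicative set that avoids [I]. *)
Lemma radical_r_idealP I : r_ideal H r I -> r_ideal H r (radical H I).
Proof.
move=> rI; have RH := @radical_sub I; split=> //; apply/seteqP; split;
  last exact: sub_r.
move=> x rx; have Hx := r_sub RH rx; apply: contrapT => nIx.
have [||P [[rP pP] IP PS]] := prime_avoiding (S :=
  [set x ^+ n | n in setT]) _ rI.
- split; first by exists 0%N.
  by move=> _ _ [n _ <-] [m _ <-]; exists (n + m)%N => //; rewrite expD.
- rewrite -subset0 => y [Iy [n _ xny]]; move: Iy; rewrite -xny {xny} => Ixn.
  apply: nIx; split=> //.
  case: n Ixn => [I1|n Ixn]; last by exists n.+1.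
  by exists 1%N => //; rewrite -[x ^+ 1]mul1g; exact: r_idealMr.
have : P x by apply: r_hull rx => //; exact: radical_prime_sub.
by move=> Px; apply: (disjointN PS Px); exists 1%N.
Qed.

(** This is how prime ideals are produced from now on: either [p] lies in the
    radical of [I] up to a factor outside [P], or the multiplicative set
    generated by [p] and the complement of [P] avoids [I]. *)
Lemma prime_or_local_radical I P p : r_ideal H r I -> prime_s_ideal H P ->
  H p ->
  (exists2 u, (H `\` P) u & radical H I (u * p)) \/
  (exists P1, [/\ prime_r_ideal H r P1, I `<=` P1, P1 `<=` P & ~ P1 p]).
Proof.
move=> rI pP Hp; have [P1 PM] := prime_compl pP.
pose S := [set z | exists u n, (H `\` P) u /\ z = u * p ^+ n].
have mS : mult_closed S.
  split; first by exists 1, 0%N; split=> //; rewrite mulg1.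
  move=> _ _ [u [n [Pu ->]]] [v [m [Pv ->]]]; exists (u * v), (n + m)%N; split.
    exact: PM.
  by rewrite expD; ac.
have [/(prime_avoiding mS rI)[Q [pQ IQ QS]]|] := pselect (I `&` S = set0);
  last first.
  move=> /eqP/set0P[z [Iz [u [n [Pu zE]]]]]; rewrite {}zE in Iz.
  left; exists u => //; have [Hu _] := Pu; split; first exact: HM.
  exists n.+1 => //; rewrite expM (expS u) (expS p).
  have -> : u * u ^+ n * (p * p ^+ n) = (u * p ^+ n) * (u ^+ n * p) by ac.
  by apply: r_idealMr => //; apply: HM => //; exact: HX.
right; exists Q; split=> // [x Qx|Qp].
  apply: contrapT => nPx; apply: (disjointN QS Qx).
  exists x, 0%N; split; last by rewrite mulg1.
  by split=> //; exact: (pQ.1.1).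
by apply: (disjointN QS Qp); exists 1, 1%N; rewrite mul1g.
Qed.

Lemma r_prime_between I P : r_ideal H r I -> prime_s_ideal H P -> I `<=` P ->
  exists P1, [/\ prime_r_ideal H r P1, I `<=` P1 & P1 `<=` P].
Proof.
move=> rI pP IP; have [[u [Hu nPu]]|[P1 [? ? ? _]]] :=
  prime_or_local_radical rI pP H1.
  by rewrite mulg1 => /(radical_prime_sub pP IP).
by exists P1.
Qed.

Lemma minimal_prime_r_ideal I P : r_ideal H r I -> minimal_primes H I P ->
  prime_r_ideal H r P.
Proof.
move=> rI [[pP IP] minP]; have [Q [rQ IQ QP]] := r_prime_between rI pP IP.
by rewrite -(minP Q) //; split=> //; case: rQ.
Qed.

(** * Invertible ideals *)

Lemma setmulC X Y : setmul X Y = setmul Y X.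
Proof.
by apply/seteqP; split=> _ [x Xx [y Yy <-]]; exists y => //; exists x => //;
  rewrite C.
Qed.

Lemma inverse_idealM X g x : inverse_ideal H X g -> X x -> H (g * x).
Proof. by move=> Xg Xx; apply: Xg; exists g => //; exists x. Qed.

Lemma inverse_idealP X g : (forall x, X x -> H (g * x)) -> inverse_ideal H X g.
Proof. by move=> Xg _ [_ -> [x Xx <-]]; exact: Xg. Qed.

Lemma mul_inverse_sub X : setmul X (inverse_ideal H X) `<=` H.
Proof. by move=> _ [x Xx [g Xg <-]]; rewrite C;
  exact: (inverse_idealM Xg Xx). Qed.

Lemma r_invertibleP I : r_ideal H r I ->
  r_invertible H r I <-> r (setmul I (inverse_ideal H I)) 1.
Proof.
move=> rI; have rII := r_idem (@mul_inverse_sub I); split=> [[_ ->] //|II1].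
split=> //; apply/seteqP; split; first by case: rII.
by move=> x Hx; rewrite -[x]mul1g; exact: r_idealMr.
Qed.

(** An invertible ideal is principal near [P]: with [s = a * g] outside [P], the
    ideal [s * J = a * (g * J)] is contained in [a * H]. *)
Lemma invertible_local J P : r_invertible H r J -> prime_r_ideal H r P ->
  exists a g, [/\ J a, nonzero H a, forall x, J x -> H (g * x) &
    (H `\` P) (a * g)].
Proof.
move=> [rJ /esym JJ] [rP pP]; apply: contrapT => nJ; apply: (prime_s_ideal1 pP).
have : r (setmul J (inverse_ideal H J)) 1 by rewrite -JJ.
apply: r_hull => //; first exact: mul_inverse_sub.
move=> _ [a Ja [g Jg <-]]; apply: contrapT => nP; apply: nJ.
have Pag : (H `\` P) (a * g) by split=> //; rewrite C;
  exact: (inverse_idealM Jg Ja).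
exists a, g; split=> //; last by move=> x Jx; exact: (inverse_idealM Jg).
exact: nonzero_divl (rJ.1 _ Ja) (prime_nonzero pP Pag).
Qed.

Lemma invertible_of_local J : r_ideal H r J ->
  (forall M, r_max H r M -> exists a g, [/\ J a, forall x, J x -> H (g * x) &
     ~ M (a * g)]) -> r_invertible H r J.
Proof.
move=> rJ locJ; apply/(r_invertibleP rJ); apply: contrapT => J1.
have [M /locJ[a [g [Ja Jg +]]] JM] :=
  exists_r_max (r_idem (@mul_inverse_sub J)) J1.
apply; apply: JM; apply: sub_r (@mul_inverse_sub J) _ _.
by exists a => //; exists g => //; exact: inverse_idealP.
Qed.

(** Write the finitely many elements needed for [1] to be in [r (J * J^-1)] as
    [a * g]; the factors [a] generate [J], since [y * (a * g) = a * (g * y)]. *)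
Lemma invertible_finitely_generated J : r_invertible H r J ->
  r_finitely_generated H r J.
Proof.
move=> [rJ /esym JJ]; split=> //.
have : r (setmul J (inverse_ideal H J)) 1 by rewrite -JJ.
move=> /(r_finitary (@mul_inverse_sub J))[s sJ rs1].
have [e [eJ es]] : exists e : seq G, [set` e] `<=` J /\
    forall y, y \in s -> exists a g, [/\ a \in e, inverse_ideal H J g & y = a *
      g].
  elim: s sJ {rs1} => [|y s IHs] sJ; first by exists [::].
  have [|e [eJ es]] := IHs; first by move=> z /= zs; apply: sJ;
    rewrite /= inE zs orbT.
  have [|a Ja [g Jg ag]] := sJ y; first by rewrite /= inE eqxx.
  exists (a :: e); split=> [z /=|z]; first by rewrite inE => /orP[/eqP->//|/eJ].
  rewrite inE => /orP[/eqP->|/es[b [h [be Jh ->]]]].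
    by exists a, g; split=> //; rewrite inE eqxx.
  by exists b, h; split=> //; rewrite inE be orbT.
have eH := subset_trans eJ rJ.1; have re := r_idem eH.
exists [set` e]; split=> //; apply/seteqP; split; last exact: r_hull.
move=> y Jy; rewrite -[y]mulg1.
apply: (r_transporter (subset_trans sJ (@mul_inverse_sub J)) re) rs1 =>
  _ /es[a [g [ae Jg ->]]].
have -> : y * (a * g) = a * (g * y) by ac.
by apply: r_idealMr => //; [exact: sub_r|exact: (inverse_idealM Jg)].
Qed.

Lemma invertible_factor X Y : X `<=` H -> Y `<=` H ->
  r_invertible H r (r (setmul X Y)) -> r_invertible H r (r X).
Proof.
move=> XH YH [rI /esym II]; have rX := r_idem XH; apply/(r_invertibleP rX).
have XYH := setmul_sub XH YH; have rXX := r_idem (@mul_inverse_sub (r X)).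
have : r (setmul (r (setmul X Y)) (inverse_ideal H (r (setmul X Y)))) 1.
  by rewrite -II.
apply: r_hull => //; first exact: mul_inverse_sub.
move=> _ [z rz [g Ig <-]]; rewrite C.
apply: (r_transporter XYH rXX) rz => _ [x Xx [y Yy <-]].
apply: sub_r (@mul_inverse_sub (r X)) _ _; exists x; first exact: sub_r.
exists (y * g); last by ac.
apply: inverse_idealP => w; apply: (r_transporter XH r_idealH) => v Xv.
rewrite -mulgA C -mulgA; apply: (inverse_idealM Ig); apply: sub_r => //.
by exists v => //; exists y.
Qed.

Lemma principal_invertible h : nonzero H h ->
  r_invertible H r (setmul [set h] H).
Proof.
move=> nh; have rh := r_ideal_principal (nonzeroH nh).
apply/(r_invertibleP rh); apply: sub_r (@mul_inverse_sub _) _ _.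
have [t ht] := nonzero_inv nh; exists h; first by exists h => //; exists 1;
  rewrite ?mulg1.
exists t => //; apply: inverse_idealP => _ [_ -> [x Hx <-]].
by rewrite mulgA (C t) ht mul1g.
Qed.

(** * Localization inside the monoid *)
(** The contraction to [H] of the extension of [X] to the localization at [P];
    with it one can argue locally and never transport [r] to a localization. *)
Definition saturation P X : set G :=
  [set y | H y /\ exists2 t, (H `\` P) t & X (t * y)].

Lemma common_multiplier P X (s : seq G) : prime_s_ideal H P -> r_ideal H r X ->
  (forall y, y \in s -> exists2 t, (H `\` P) t & X (t * y)) ->
  exists2 t, (H `\` P) t & forall y, y \in s -> X (t * y).
Proof.
move=> pP rX; elim: s => [|y s IHs] sX; first by exists 1 => //;
  case: (prime_compl pP).
have [|t Pt sXt] := IHs; first by move=> z zs; apply: sX; rewrite inE zs orbT.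
have [|u Pu Xu] := sX y; first by rewrite inE eqxx.
exists (t * u); first exact: primeN_M.
move=> z; rewrite inE => /orP[/eqP->|/sXt Xtz].
  by rewrite -mulgA; apply: r_idealMl Xu _ => //; case: Pt.
by have -> : t * u * z = u * (t * z) by [ac]; apply: r_idealMl => //; case: Pu.
Qed.

Lemma saturation_r_ideal P X : prime_s_ideal H P -> r_ideal H r X ->
  r_ideal H r (saturation P X).
Proof.
move=> pP rX; have satH : saturation P X `<=` H by move=> y [].
split=> //; apply/seteqP; split; last exact: sub_r.
move=> y ry; split; first exact: r_sub ry.
have [s sX rsy] := r_finitary satH ry.
have [|t Pt tX] := common_multiplier (s := s) pP rX; first by move=> z /sX[].
exists t => //; exact: (r_transporter (subset_trans sX satH) rX) rsy.
Qed.

Lemma saturation_sub P X : prime_s_ideal H P -> r_ideal H r X ->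
  X `<=` saturation P X.
Proof.
move=> pP rX x Xx; split; first exact: rX.1.
by exists 1; [case: (prime_compl pP)|rewrite mul1g].
Qed.

Lemma saturationM P X Y Z x y : prime_s_ideal H P ->
  (forall x y, X x -> Y y -> Z (x * y)) ->
  saturation P X x -> saturation P Y y -> saturation P Z (x * y).
Proof.
move=> pP XYZ [Hx [t Pt Xt]] [Hy [u Pu Yu]]; split; first exact: HM.
exists (t * u); first exact: primeN_M.
by have -> : t * u * (x * y) = (t * x) * (u * y) by [ac]; exact: XYZ.
Qed.

Lemma saturation_principalM P a b x y : prime_s_ideal H P ->
  saturation P (setmul [set a] H) x -> saturation P (setmul [set b] H) y ->
  saturation P (setmul [set a * b] H) (x * y).
Proof.
move=> pP; apply: saturationM =>
  // v w /principalP[v' Hv ->] /principalP[w' Hw ->].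
by apply/principalP; exists (v' * w'); [exact: HM|ac].
Qed.

(** The [t] with [t * y] in [I] form an r-ideal that no maximal one contains. *)
Lemma local_global I y : r_ideal H r I -> H y ->
  (forall M, r_max H r M -> saturation M I y) -> I y.
Proof.
move=> rI Hy locI; pose T : set G := [set t | H t /\ I (t * y)].
have TH : T `<=` H by move=> t [].
have rT : r_ideal H r T.
  split=> //; apply/seteqP; split; last exact: sub_r.
  move=> t rt; split; first exact: r_sub rt.
  by rewrite C; apply: (r_transporter TH rI) rt => x [_]; rewrite C.
have [T1|T1] := pselect (T 1); first by case: T1; rewrite mul1g.
have [M maxM TM] := exists_r_max rT T1.
have [_ [t [Ht nMt] It]] := locI M maxM.
by case: nMt; apply: TM.
Qed.

(** Zorn's lemma is applied to the parts of [P] that can be removed from [P]. *)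
Lemma exists_minimal_prime I P : prime_s_ideal H P -> I `<=` P ->
  exists2 Q, minimal_primes H I Q & Q `<=` P.
Proof.
move=> pP IP.
pose F : set (set G) := [set A | prime_s_ideal H (P `\` A) /\ I `<=` P `\` A].
have [|A [[pA IA] maxA]] := Zorn_bigcup (P := F).
  move=> D DF totD; have PH : P `<=` H by case: pP => -[].
  have DE x : (P `\` \bigcup_(X in D) X) x <-> P x /\ forall X, D X ->
    (P `\` X) x.
    split=> [[Px nDx]|[Px nX]]; split=> //.
      by move=> X DX; split=> // Xx; apply: nDx; exists X.
    by move=> [X DX Xx]; case: (nX X DX).
  split; last first.
    move=> x Ix; apply/DE; split; first exact: IP.
    by move=> X DX; case: (DF X DX) => _; apply.
  split.
  - split; first by move=> x [/PH].
    apply/seteqP; split=> x.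
      by move=> Dx; left; exists x => //; exists 1; rewrite ?mulg1.
    case=> [[y /DE[Py Dy] [h Hh <-]]|zx]; apply/DE; split.
    + by apply: s_idealMr => //; case: pP.
    + by move=> X DX; apply: s_idealMr (Dy X DX) Hh; case: (DF X DX) => -[].
    + by apply: s_ideal_zeros zx; case: pP.
    + by move=> X DX; apply: s_ideal_zeros zx; case: (DF X DX) => -[].
  - by move=> DeH; apply: (prime_s_ideal1 pP); have : H 1 by [];
    rewrite -DeH => -[].
  - move=> x y Hx Hy /DE[Pxy Dxy]; apply: contrapT => /not_orP[nx ny].
    have out z : H z -> ~ (P `\` \bigcup_(X in D) X) z ->
      ~ P z \/ exists2 X, D X & ~ (P `\` X) z.
      move=> Hz nz; have [Pz|] := pselect (P z); last by left.
      right; apply: contrapT => nX; apply: nz; apply/DE; split=> // X DX.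
      by apply: contrapT => nXz; apply: nX; exists X.
    have [_ _ ppP] := pP.
    have anti X Y z : X `<=` Y -> ~ (P `\` X) z -> ~ (P `\` Y) z.
      by move=> XY nXz [Pz nYz]; apply: nXz; split=> // /XY.
    have key X : D X -> ~ (P `\` X) x -> ~ (P `\` X) y -> False.
      move=> DX nXx nXy; have [[_ _ pX] _] := DF X DX.
      by case: (pX x y Hx Hy (Dxy X DX)).
    have sub X z : ~ P z -> ~ (P `\` X) z by move=> nz [].
    have [nPx|[X DX nXx]] := out _ Hx nx; have [nPy|[Y DY nYy]] := out _ Hy ny.
    + by case: (ppP x y Hx Hy Pxy).
    + exact: (key Y DY (sub _ _ nPx)).
    + exact: (key X DX nXx (sub _ _ nPy)).
    + have [XY|YX] := totD _ _ DX DY.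
        exact: (key Y DY (anti _ _ _ XY nXx)).
      exact: (key X DX nXx (anti _ _ _ YX nYy)).
exists (P `\` A); last by move=> x [].
split=> // Q [pQ IQ] QA; apply/seteqP; split=> //; apply: contrapT => nAQ.
have QP : Q `<=` P by move=> x /QA[].
have AQ : A `<=` P `\` Q `|` A by right.
have QE : P `\` (P `\` Q `|` A) = Q.
  apply/seteqP; split=> x.
    by move=> [Px /not_orP[nPQ _]]; apply: contrapT => nQx; apply: nPQ.
  by move=> Qx; split; [exact: QP|move=> [[_ /(_ Qx)]|Ax] //; case: (QA x Qx)].
apply: (maxA (P `\` Q `|` A)); last by rewrite /F /= QE.
split=> // sub; apply: nAQ => x [Px nAx]; apply: contrapT => nQx.
by apply: nAx; apply: sub; left.
Qed.

(** * Gaps between primes *)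

(** Near [Q] the ideal [J] is generated by one element [a] of [P].  As [Q] is the
    only prime in [Q] that contains [x], some power of [a] is a multiple of [x]
    up to a factor [t] outside [Q], say [t * a ^+ n = x * b].  If [x] is not in
    [P], then [b] is in [P], so in [Q]; and any prime between [J] and [Q] contains
    [b], because it is [Q] or does not contain [x].  Since [J] is radical, it
    contains [b] near [Q], so that [a] can be cancelled.  The descent ends with
    [t = x * b], which contradicts [t] being outside [Q]. *)
Lemma prime_gap Q x J P : prime_r_ideal H r Q -> Q x ->
  (forall P1, prime_r_ideal H r P1 -> P1 `<=` Q -> P1 x -> P1 = Q) ->
  radical H J = J -> r_invertible H r J ->
  prime_r_ideal H r P -> J `<=` P -> P `<=` Q -> P = Q.
Proof.
move=> [rQ pQ] Qx minQ radJ invJ [rP pP] JP PQ.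
have [Px|nPx] := pselect (P x); first exact: minQ.
have [a [g [Ja na Jg Ps]]] := invertible_local invJ (conj rQ pQ).
have Hx : H x := rQ.1 _ Qx.
have Ha : H a := nonzeroH na.
have descent n t : (H `\` Q) t -> ~ (setmul [set x] H) (t * a ^+ n).
  elim: n t => [|n IHn] t Qt.
    by rewrite mulg1 => -[_ -> [h Hh th]]; case: Qt => _; apply; rewrite -th;
      exact: r_idealMr.
  move=> [_ -> [b Hb xb]]; have [Ht _] := Qt.
  have Jta : J (t * a ^+ n.+1).
    have -> : t * a ^+ n.+1 = (t * a ^+ n) * a by rewrite expS; ac.
    by apply: r_idealMl => //; [exact: invJ.1|apply: HM => //; exact: HX].
  have Qb : Q b.
    by apply: PQ; apply: (primeNM pP (conj Hx nPx)) => //; rewrite xb;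
      exact: JP.
  have [[u Qu]|[P1 [[rP1 pP1] JP1 P1Q nP1b]]] :=
    prime_or_local_radical invJ.1 pQ Hb.
    rewrite radJ => Jub; have [Hu _] := Qu.
    apply: (IHn (a * g * (u * t))); first by apply: primeN_M => //;
      exact: primeN_M.
    exists x => //; exists (g * (u * b)); first exact: Jg.
    apply: (nonzeroI na).
    have -> : a * (x * (g * (u * b))) = g * u * a * (x * b) by ac.
    rewrite xb expS; ac.
  have P1x : P1 x.
    by apply: (primeNM pP1 (conj Hb nP1b)) => //; rewrite C xb; exact: JP1.
  by case: nP1b; rewrite (minQ P1).
have [[u Qu [_ [n _ xuan]]]|[P1 [pP1 xP1 P1Q nP1a]]] :=
    prime_or_local_radical (r_ideal_principal Hx) pQ Ha.
  by case: (descent n (u ^+ n)); [exact: primeN_X|rewrite -expM].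
case: nP1a; rewrite (minQ P1) //; first by apply: PQ; exact: JP.
by apply: xP1; exists x => //; exists 1; rewrite ?mulg1.
Qed.

(** * Dimension one *)

Definition dim_one := forall P Q, prime_r_ideal H r P -> prime_r_ideal H r Q ->
  nontrivial H P -> P `<=` Q -> P = Q.

Lemma nontrivialP X : s_ideal H X ->
  nontrivial H X <-> exists2 x, X x & nonzero H x.
Proof.
move=> sX; split=> [[_ nX]|[x Xx [Hx nx]]].
  apply: contrapT => nx; apply: nX => x Xx; apply: contrapT => nzx.
  by apply: nx; exists x => //; split=> //; exact: s_ideal_sub Xx.
by split; [exact: s_ideal_zeros|move=> /(_ _ Xx)].
Qed.

Lemma nontrivial_sub X Y : nontrivial H X -> X `<=` Y -> nontrivial H Y.
Proof.
by move=> [zX nX] XY; split; [exact: subset_trans XY|move=> Yz; apply: nX;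
  exact: subset_trans Yz].
Qed.

Lemma trivial_s_ideal X : s_ideal H X -> ~ nontrivial H X -> X = zeros H.
Proof.
move=> sX nX; apply/seteqP; split; last exact: s_ideal_zeros.
by apply: contrapT => nXz; apply: nX; split=> //; exact: s_ideal_zeros.
Qed.

Lemma principal_nontrivial h : nonzero H h -> nontrivial H (setmul [set h] H).
Proof.
move=> nh; apply/nontrivialP;
  first exact: r_ideal_s_ideal (r_ideal_principal (nonzeroH nh)).
by exists h => //; exact: principal_self.
Qed.

Lemma r_max_nontrivial_prime P : dim_one -> prime_r_ideal H r P ->
  nontrivial H P -> r_max H r P.
Proof.
move=> dim [rP pP] ntP; have [M maxM PM] := exists_r_max rP (prime_s_ideal1 pP).
by rewrite (dim P M) //; exact: r_max_prime.
Qed.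

(** A prime r-ideal over [I] inside [P] can only be [P], which contains [p]; so
    the second alternative of [prime_or_local_radical] is excluded. *)
Lemma local_radical P I p : dim_one -> prime_r_ideal H r P -> r_ideal H r I ->
  nontrivial H I -> P p -> exists2 u, (H `\` P) u & radical H I (u * p).
Proof.
move=> dim rpP rI ntI Pp; have [rP pP] := rpP.
have [//|[P1 [rpP1 IP1 P1P nP1p]]] := prime_or_local_radical rI pP (rP.1 _ Pp).
by case: nP1p; rewrite (dim P1 P) //; exact: nontrivial_sub IP1.
Qed.

(** An element that generates [P] in the localization at [P]. *)
Definition uniformizer P a :=
  [/\ P a, nonzero H a & P `<=` saturation P (setmul [set a] H)].

(** Near [P] the radical ideal [J] is all of [P], and it is generated by [a]. *)
Lemma uniformizer_of_invertible P J a g : dim_one -> prime_r_ideal H r P ->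
  r_ideal H r J -> radical H J = J -> J `<=` P ->
  J a -> nonzero H a -> (forall x, J x -> H (g * x)) -> (H `\` P) (a * g) ->
  uniformizer P a.
Proof.
move=> dim rpP rJ radJ JP Ja na Jg Pag; have [rP pP] := rpP; split=> //;
  first exact: JP.
have ntJ : nontrivial H J by apply/(nontrivialP (r_ideal_s_ideal rJ)); exists a.
move=> y Py; split; first exact: rP.1.
have [u Pu] := local_radical dim rpP rJ ntJ Py; rewrite radJ => Juy.
exists (a * g * u); first exact: primeN_M.
apply/principalP; exists (g * (u * y)); first exact: Jg.
ac.
Qed.

Lemma exists_uniformizer P : dim_one -> primes_contain_invertible_radical H r ->
  prime_r_ideal H r P -> nontrivial H P -> exists a, uniformizer P a.
Proof.
move=> dim pcJ rpP ntP; have [J [[rJ radJ] invJ JP]] := pcJ P rpP ntP.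
have [a [g [Ja na Jg Pag]]] := invertible_local invJ rpP.
by exists a; exact: (uniformizer_of_invertible dim rpP rJ radJ JP Ja na Jg Pag).
Qed.

(** In the localization at [P] each nonzero element is a unit times a power of
    [a].  Some power of [a] is a multiple of [y] near [P]; this bounds the number
    of times that [a] can be split off from [y]. *)
Lemma valuation P a y : dim_one -> prime_r_ideal H r P -> uniformizer P a ->
  nonzero H y ->
  exists k t u, [/\ (H `\` P) t, (H `\` P) u & t * y = u * a ^+ k].
Proof.
move=> dim rpP [Pa na satP] ny; have [rP pP] := rpP.
have Hy := nonzeroH ny; have Ha := nonzeroH na.
have [P1 PM] := prime_compl pP.
have claim n : forall t z, H z -> (H `\` P) t ->
  setmul [set z] H (t * a ^+ n) ->
    exists k s u, [/\ (H `\` P) s, (H `\` P) u & s * z = u * a ^+ k].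
  elim: n => [|n IHn] t z Hz Pt zt.
    have [Pz|nPz] := pselect (P z); last first.
      by exists 0%N, 1, z; split=> //; rewrite mul1g mulg1.
    move: zt; rewrite mulg1 => /principalP[w Hw tE]; case: Pt => _; case.
    by rewrite tE; exact: r_idealMr.
  have [Pz|nPz] := pselect (P z); last first.
    by exists 0%N, 1, z; split=> //; rewrite mul1g mulg1.
  have [_ [s Ps /principalP[z' Hz' sz]]] := satP z Pz.
  case/principalP: zt => w Hw tE.
  have [|k [v [u [Pv Pu vz]]]] := IHn (s * t) z' Hz' (PM _ _ Ps Pt).
    apply/principalP; exists w => //; apply: (nonzeroI na).
    have -> : a * (s * t * a ^+ n) = s * (t * (a * a ^+ n)) by ac.
    by rewrite -expS tE mulgA sz; ac.
  exists k.+1, (v * s), u; split=> //; first exact: PM.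
  rewrite -mulgA sz expS.
  have -> : u * (a * a ^+ k) = a * (u * a ^+ k) by ac.
  by rewrite -vz; ac.
have [u Pu [_ [n _ zua]]] :=
  local_radical dim rpP (r_ideal_principal Hy) (principal_nontrivial ny) Pa.
by apply: (claim n (u ^+ n)) => //; [exact: primeN_X|rewrite -expM].
Qed.

Lemma setprod_sub (s : seq (set G)) :
  (forall i, (i < size s)%N -> nth set0 s i `<=` H) -> setprod s `<=` H.
Proof.
elim: s => [|X s IHs] sH; first by move=> _ ->.
apply: setmul_sub; first exact: (sH 0%N).
by apply: IHs => i lti; exact: (sH i.+1).
Qed.

Lemma setmul1 X : setmul X [set 1] = X.
Proof.
apply/seteqP; split=> [_ [x Xx [_ -> <-]]|x Xx]; first by rewrite mulg1.
by exists x => //; exists 1; rewrite ?mulg1.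
Qed.

Lemma setprod_nseq_sub k X : X `<=` H -> setprod (nseq k X) `<=` H.
Proof.
by move=> XH; apply: setprod_sub => i; rewrite size_nseq => lti;
  rewrite nth_nseq lti.
Qed.

Lemma setprod_nseqX k X x : X x -> setprod (nseq k X) (x ^+ k).
Proof.
move=> Xx; elim: k => [|k IHk] //=; exists x => //; exists (x ^+ k) => //.
by rewrite expS.
Qed.

Lemma setprod_nseqS k X : r_ideal H r X -> setprod (nseq k.+1 X) `<=` X.
Proof.
move=> rX _ [x Xx [y Xy <-]]; apply: r_idealMr => //.
by apply: setprod_nseq_sub Xy; exact: rX.1.
Qed.

Lemma radical_power P k : prime_r_ideal H r P -> (0 < k)%N ->
  radical H (r (setprod (nseq k P))) = P.
Proof.
move=> [rP pP]; case: k => // k _; have PH := rP.1.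
have kH := @setprod_nseq_sub k.+1 P PH.
apply/seteqP; split.
  by apply: radical_prime_sub => //; apply: r_hull => //; exact: setprod_nseqS.
move=> x Px; split; first exact: PH.
by exists k.+1 => //; apply: sub_r => //; exact: setprod_nseqX.
Qed.

(** As [M] is the only maximal r-ideal over [I], for [y] outside [M] the r-ideal
    [r (I, y)] contains [1]; multiplying by [x] gives [x] in [r (x * I, x * y)],
    hence in [I]. *)
Lemma primary_of_r_max M I : r_max H r M -> r_ideal H r I -> radical H I = M ->
  primary_r_ideal H r I.
Proof.
move=> maxM rI radI; have [rM pM] := r_max_prime maxM.
have IM : I `<=` M by rewrite -radI; apply: sub_radical; exact: rI.1.
split=> //; split; first exact: r_ideal_s_ideal.
  by apply/(r_ideal_proper rI) => /IM; exact: prime_s_ideal1.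
move=> x y Hx Hy Ixy nIx; rewrite radI; apply: contrapT => nMy.
have IyH : I `|` [set y] `<=` H by move=> z [/rI.1|->].
have [Iy1|Iy1] := pselect (r (I `|` [set y]) 1).
  apply: nIx; rewrite -[x]mulg1;
    apply: (r_transporter IyH rI) Iy1 => z [Iz|-> //].
  exact: r_idealMl.
have [N maxN IN] := exists_r_max (r_idem IyH) Iy1.
have [rN pN] := r_max_prime maxN.
have Ny : N y by apply: IN; apply: sub_r => //; right.
apply: nMy; suff <- : N = M by [].
apply: (proj2 maxM); first by split=> //; case: pN.
by rewrite -radI; apply: radical_prime_sub => // z Iz; apply: IN;
  apply: sub_r => //; left.
Qed.

Lemma primary_radical_prime I : primary_r_ideal H r I ->
  prime_r_ideal H r (radical H I).
Proof.
move=> [rI [sI InH pI]]; have rR := radical_r_idealP rI.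
split=> //; split; first exact: r_ideal_s_ideal.
  apply/(r_ideal_proper rR) => -[_ [n _]]; rewrite expg1n.
  by move/(r_ideal_proper rI): InH.
move=> x y Hx Hy [_ [n n0 Ixy]]; rewrite expM in Ixy.
have [Ixn|nIxn] := pselect (I (x ^+ n)); first by left; split=> //; exists n.
right; rewrite -radical_idem; split=> //; exists n => //.
exact: (pI _ _ (HX n Hx) (HX n Hy)).
Qed.

Lemma primary_saturated I y t : primary_r_ideal H r I -> H y ->
  (H `\` radical H I) t -> I (t * y) -> I y.
Proof.
move=> [_ [_ _ pI]] Hy [Ht nt] Ity; apply: contrapT => nIy.
by apply: nt; apply: (pI y t) => //; rewrite C.
Qed.

(** A primary ideal is determined near its radical [M]; there it is generated by
    [a ^+ k] for the least [k] with [a ^+ k] in [I], and so is the [k]-th power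
    of [M], which is primary because [M] is maximal. *)
Lemma prime_power_of_dim_one : dim_one ->
  primes_contain_invertible_radical H r -> r_prime_power_condition H r.
Proof.
move=> dim pcJ I priI; have rI := priI.1; have sI := r_ideal_s_ideal rI.
have rpM := primary_radical_prime priI; set M := radical H I in rpM *.
have [rM pM] := rpM.
have IM : I `<=` M by apply: sub_radical; exact: rI.1.
have powH k := @setprod_nseq_sub k M rM.1.
have [ntM|/(trivial_s_ideal (r_ideal_s_ideal rM)) zM] :=
  pselect (nontrivial H M); last first.
  exists 1%N => //=; rewrite setmul1; case: rM => _ ->.
  by apply/seteqP; split=> //; rewrite zM; exact: s_ideal_zeros.
have maxM := r_max_nontrivial_prime dim rpM ntM.
have [a ua] := exists_uniformizer dim pcJ rpM ntM; have [Ma na satM] := ua.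
have Ha := nonzeroH na.
have Iak y k t u : I y -> (H `\` M) t -> (H `\` M) u ->
  t * y = u * a ^+ k -> I (a ^+ k).
  move=> Iy [Ht _] Mu E; apply: (primary_saturated priI (HX _ Ha) Mu).
  by rewrite -E; exact: r_idealMl.
have [k Ik mink] : exists2 k, I (a ^+ k) & forall j, I (a ^+ j) -> (k <= j)%N.
  by apply: least_nat; have [_ [n _ Ian]] := Ma; exists n.
have k0 : (0 < k)%N.
  by case: k Ik {mink} => // I1; case: (prime_s_ideal1 pM); exact: IM.
exists k => //; apply/seteqP; split.
  have radk := radical_power rpM k0.
  have rk := r_idem (powH k).
  have prik := primary_of_r_max maxM rk radk.
  move=> y Iy; have Hy := rI.1 _ Iy.
  have [zy|nzy] := pselect (zeros H y).
    by apply: s_ideal_zeros zy; exact: r_ideal_s_ideal rk.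
  have [j [t [u [Mt Mu E]]]] := valuation dim rpM ua (conj Hy nzy).
  apply: (primary_saturated (t := t) prik Hy); first by rewrite radk.
  have kj := mink _ (Iak _ _ _ _ Iy Mt Mu E).
  rewrite E -(subnKC kj) expD; apply: r_idealMl => //; last by case: Mu.
  apply: r_idealMr => //; last exact: HX.
  by apply: sub_r => //; exact: setprod_nseqX.
apply: r_hull => // y My; apply: contrapT => nIy.
have satk : saturation M (setmul [set a ^+ k] H) y.
  elim: k y My {Ik mink k0 nIy} => [|k IHk] y.
    move=> ->; apply: saturation_sub => //; first exact: r_ideal_principal.
    exact: principal_self.
  move=> [x Mx [z Mz <-]]; rewrite expS.
  exact: saturation_principalM pM (satM x Mx) (IHk z Mz).
have [Hy [t Mt /principalP[w Hw tE]]] := satk.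
apply: nIy; apply: (primary_saturated priI Hy Mt).
by rewrite tE; exact: r_idealMr.
Qed.

(** Here [P] is trivial and the r-square of [Q] does the job: it does not contain
    a uniformizer [a] of [Q], as near [Q] it is generated by [a * a]. *)
Lemma inclusive_of_dim_one : dim_one -> primes_contain_invertible_radical H r ->
  primary_r_ideal_inclusive H r.
Proof.
move=> dim pcJ P Q rpP rpQ [PQ nQP].
have [rP pP] := rpP; have [rQ pQ] := rpQ.
have zP : P = zeros H.
  apply: trivial_s_ideal; first exact: r_ideal_s_ideal.
  by move=> ntP; apply: nQP; rewrite (dim P Q).
have ntQ : nontrivial H Q by rewrite zP in PQ nQP; split.
have maxQ := r_max_nontrivial_prime dim rpQ ntQ.
have [a ua] := exists_uniformizer dim pcJ rpQ ntQ; have [Qa na satQ] := ua.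
have QH := rQ.1; have QQH := @setprod_nseq_sub 2 Q QH.
have rI := r_idem QQH; have radI := radical_power rpQ (isT : (0 < 2)%N).
exists (r (setprod (nseq 2 Q))); rewrite radI; split=> //.
- exact: primary_of_r_max maxQ rI radI.
- by rewrite zP; apply: s_ideal_zeros; exact: r_ideal_s_ideal.
- split; first by apply: r_hull => //; exact: setprod_nseqS.
  move=> /(_ _ Qa) ra.
  have HaH := r_ideal_principal (nonzeroH (nonzeroM na na)).
  have : saturation Q (setmul [set a * a] H) a.
    apply: r_hull ra => //; first exact: saturation_r_ideal.
    move=> _ [x Qx [_ [y Qy [_ -> <-]] <-]]; rewrite mulg1.
    exact: saturation_principalM pQ (satQ x Qx) (satQ y Qy).
  move=> [_ [t [Ht nQt] /principalP[w Hw tE]]]; apply: nQt.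
  have -> : t = a * w by apply: (nonzeroI na); rewrite C tE; ac.
  exact: r_idealMr.
Qed.

(** * Invertible radicals *)

Definition fg_radicals_invertible := forall I, r_finitely_generated H r I ->
  nontrivial H I -> r_invertible H r (radical H I).

(** For a maximal [M] over [I] choose [J], [a], [g] such that [a * g] is outside
    [M] and [g * J] in [H].  The ideals [J] and [radical H I] agree near [M] but
    may differ at other maximal ideals.  As [I] is finitely generated, one factor
    [w] outside [M] brings [I], hence its radical, into [J]; so [g * w] is in the
    inverse of the radical.  A factor [u] outside [M] brings [a] into the radical,
    and the product [(u * a) * (g * w)] is outside [M]. *)
Lemma radical_invertible_of_dim_one : dim_one ->
  primes_contain_invertible_radical H r -> fg_radicals_invertible.
Proof.
move=> dim pcJ I [rI [E [/finite_seqP[s ->] EI IE]]] ntI.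
have IH := rI.1; apply: invertible_of_local; first exact: radical_r_idealP.
move=> M maxM; have rpM := r_max_prime maxM; have [rM pM] := rpM.
have [IM|nIM] := pselect (I `<=` M); last first.
  have [t It nMt] := nsubset_witness nIM.
  exists t, 1; split; rewrite ?mulg1 //; first exact: sub_radical.
  by move=> x [Hx _]; rewrite mul1g.
have ntM := nontrivial_sub ntI IM.
have [J [[rJ radJ] invJ JM]] := pcJ M rpM ntM.
have [a [g [Ja na Jg Mag]]] := invertible_local invJ rpM.
have ntJ : nontrivial H J by apply/(nontrivialP (r_ideal_s_ideal rJ)); exists a.
have [|w Mw wJ] := common_multiplier (s := s) pM rJ.
  move=> y ys; have My : M y by apply: IM; exact: EI.
  by have [u Mu] := local_radical dim rpM rJ ntJ My; rewrite radJ => ?;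
    exists u.
have [u Mu Iua] := local_radical dim rpM rI ntI (JM _ Ja).
have Hw : H w by case: Mw.
have wIJ x : I x -> J (w * x).
  by rewrite {1}IE; apply: r_transporter => //; exact: subset_trans IH.
exists (u * a), (g * w); split=> //.
  move=> x [Hx [n n0 Ixn]]; rewrite -mulgA; apply: Jg.
  rewrite -radJ; split; first exact: HM.
  exists n => //; rewrite expM; case: n n0 Ixn => // n _ Ixn.
  rewrite expS -mulgA C -mulgA; apply: r_idealMl => //; last exact: HX.
  by rewrite C; exact: wIJ.
have -> : u * a * (g * w) = u * (a * g) * w by ac.
by case: (primeN_M pM (primeN_M pM Mu Mag) Mw).
Qed.

Lemma principal_idealE I : principal_ideal H I -> nontrivial H I ->
  exists2 h, nonzero H h & I = setmul [set h] H.
Proof.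
move=> [A [AH A1 IE]] ntI.
have [h Ah] : exists h, A h.
  apply: contrapT => nA; case: ntI => _; apply; rewrite IE => x [[a Aa _]|//].
  by case: nA; exists a.
have AE : A = [set h] by apply/seteqP; split=> [x Ax|x ->] //; exact: A1.
have rh := r_ideal_principal (AH h Ah).
have {}IE : I = setmul [set h] H.
  rewrite IE AE; apply/seteqP; split=> [x [//|zx]|x]; last by left.
  by apply: s_ideal_zeros zx; exact: r_ideal_s_ideal.
exists h => //; split; first exact: AH.
move=> [_ zh]; case: ntI => _; apply; rewrite IE => _ [_ -> [w Hw <-]].
by rewrite zh //; split; [exact: AH|].
Qed.

Lemma principal_ideal_setmul h : H h -> principal_ideal H (setmul [set h] H).
Proof.
move=> Hh; exists [set h]; split; first by move=> x ->.
  by move=> x y -> ->.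
apply/seteqP; split=> [x|x [//|zx]]; first by left.
by apply: s_ideal_zeros zx; exact: r_ideal_s_ideal (r_ideal_principal Hh).
Qed.

Lemma principal_finitely_generated h : nonzero H h ->
  r_finitely_generated H r (setmul [set h] H).
Proof. by move=> nh; apply: invertible_finitely_generated;
  exact: principal_invertible. Qed.

(** The radical of [I] is generated near [P] by some [b], so [P] is minimal over
    [b]; a nontrivial prime properly inside [P] would contain the invertible
    radical of a principal ideal, contrary to [prime_gap]. *)
Lemma minimal_primes_height_one : fg_radicals_invertible ->
  forall I, r_finitely_generated H r I -> nontrivial H I ->
    minimal_primes H I `<=` height_one_primes H.
Proof.
move=> invR I fgI ntI P minP; have rI := fgI.1.
have rpP := minimal_prime_r_ideal rI minP; have [rP pP] := rpP.
have [[_ IP] miniP] := minP; have ntP := nontrivial_sub ntI IP.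
split=> // Q [pQ ntQ] QP.
have [sQ _ _] := pQ; have [x Qx nx] := (nontrivialP sQ).1 ntQ.
have rx := r_ideal_principal (nonzeroH nx).
have [|P0 [rpP0 xP0 P0Q]] := r_prime_between rx pQ.
  exact: principal_sub.
have invJ := invR _ (principal_finitely_generated nx) (principal_nontrivial nx).
have JP0 := radical_prime_sub rpP0.2 xP0.
have [b [g [Rb _ Rg Pbg]]] := invertible_local (invR _ fgI ntI) rpP.
have Pb : P b by exact: (radical_prime_sub pP IP).
have P0P : P0 = P.
  apply: (prime_gap rpP Pb _ (radical_idem _) invJ rpP0 JP0);
    last exact: subset_trans QP.
  move=> P1 [rP1 pP1] P1P P1b; apply: miniP => //; split=> // y Iy.
  have nP1bg : (H `\` P1) (b * g) by case: Pbg => Hbg nbg; split=> // /P1P.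
  apply: (primeNM pP1 nP1bg (rI.1 _ Iy)).
  rewrite -mulgA; apply: r_idealMr => //; apply: Rg.
  exact: sub_radical rI.1 _ Iy.
by apply/seteqP; split=> //; rewrite -P0P.
Qed.

(** Let [x] be in [P] and [y] in [Q] but not in [P].  Let [b] and [c] be local
    generators at [Q] of the radicals of [y * H] and of [x * y * H]; then
    [c = b * e] near [Q].  If [e] were in [Q], a minimal prime [P1] of [r (b, e)]
    inside [Q] would have height one, and [c = b * e] would be in the square of
    [P1] near [P1] although the radical of [x * y * H] is equal to [P1]
    there.  So [e] is a unit near [Q]: both radicals agree near [Q], and [P], which
    contains the second one, contains [y]. *)
Lemma dim_one_of_height_one :
  (forall I, r_finitely_generated H r I -> nontrivial H I ->
    minimal_primes H I `<=` height_one_primes H) ->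
  (forall I, principal_ideal H I -> nontrivial H I ->
    r_invertible H r (radical H I)) ->
  dim_one.
Proof.
move=> ht1 invR P Q [rP pP] rpQ ntP PQ; have [rQ pQ] := rpQ.
apply/seteqP; split=> // y Qy; apply: contrapT => nPy.
have [x Px nx] := (nontrivialP (r_ideal_s_ideal rP)).1 ntP.
have Hy := rQ.1 _ Qy; have Hx := nonzeroH nx.
have ny : nonzero H y by apply: (prime_nonzero pP); split.
have nxy := nonzeroM nx ny.
have invp h : nonzero H h -> r_invertible H r (radical H (setmul [set h] H)).
  move=> nh; apply: invR; last exact: principal_nontrivial.
  by apply: principal_ideal_setmul; exact: nonzeroH.
set B := radical H (setmul [set y] H);
  set D := radical H (setmul [set x * y] H).
have invB : r_invertible H r B by exact: invp.
have invD : r_invertible H r D by exact: invp.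
have [b [g [Bb nb Bg Qbg]]] := invertible_local invB rpQ.
have [c [d [Dc nc Dd Qcd]]] := invertible_local invD rpQ.
have DB : D `<=` B.
  apply: radical_mono => _ /principalP[w Hw ->]; apply/principalP.
  by exists (x * w); [exact: HM|ac].
have Hyy h : H h -> setmul [set h] H `<=` H.
  by move=> Hh _ /principalP[w Hw ->]; exact: HM.
have By : B y by apply: sub_radical (principal_self y); exact: Hyy.
have DP : D `<=` P.
  apply: radical_prime_sub => // _ /principalP[w Hw ->].
  by rewrite -mulgA; apply: r_idealMr => //; exact: HM.
(* Up to the factor [b * g] outside [Q], this is the quotient of [c] by [b]. *)
pose e := c * g.
have He : H e by rewrite /e C; apply: Bg; exact: DB.
have ce : c * (b * g) = b * e by rewrite /e; ac.
have nQe : ~ Q e.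
  move=> Qe; have bQ : B `<=` Q.
    by apply: radical_prime_sub => //; apply: principal_sub => //; case: pQ.
  have Hb := nonzeroH nb.
  have beH : [set` [:: b; e]] `<=` H by move=> z /=;
    rewrite !inE => /orP[]/eqP->.
  have beQ : r [set` [:: b; e]] `<=` Q.
    apply: r_hull => // z /=; rewrite !inE => /orP[]/eqP-> //; exact: bQ.
  have rbe := r_idem beH.
  have inb : r [set` [:: b; e]] b by apply: sub_r => //=; rewrite !inE eqxx.
  have ine : r [set` [:: b; e]] e by apply: sub_r => //=;
    rewrite !inE eqxx orbT.
  have ntbe : nontrivial H (r [set` [:: b; e]]).
    by apply/(nontrivialP (r_ideal_s_ideal rbe)); exists b.
  have fgbe : r_finitely_generated H r (r [set` [:: b; e]]).
    split=> //; exists [set` [:: b; e]]; split=> //.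
    exact: sub_r.
  have [P1 minP1 P1Q] := exists_minimal_prime pQ beQ.
  have [rP1 pP1] := minimal_prime_r_ideal rbe minP1.
  have [_ htP1] := ht1 _ fgbe ntbe _ minP1.
  have [[_ beP1] _] := minP1.
  have P1b := beP1 _ inb; have P1e := beP1 _ ine.
  have notP1 z : (H `\` Q) z -> (H `\` P1) z by move=> [Hz nQz];
    split=> // /P1Q.
  have P1c : P1 c.
    apply: (primeNM pP1 (notP1 _ Qbg) (nonzeroH nc)).
    by rewrite C ce; exact: r_idealMr.
  have DP1 : D `<=` P1.
    move=> z Dz; apply: (primeNM pP1 (notP1 _ Qcd)); first exact: invD.1.1.
    by rewrite -mulgA; apply: r_idealMr => //; exact: Dd.
  have [[u P1u]|[P2 [[rP2 pP2] DP2 P2P1 nP2b]]] :=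
    prime_or_local_radical invD.1 pP1 Hb.
    rewrite radical_idem => Dub.
    have [] := primeN_M pP1 (primeN_M pP1 P1u (notP1 _ Qbg)) (notP1 _ Qcd).
    move=> _; apply.
    have -> : u * (b * g) * (c * d) = e * (d * (u * b)).
      apply: (nonzeroI nb).
      have -> : b * (e * (d * (u * b))) = (b * e) * (d * (u * b)) by ac.
      by rewrite -ce; ac.
    by apply: r_idealMr => //; exact: Dd.
  apply: nP2b; rewrite (htP1 P2) //; split=> //.
  apply: (nontrivial_sub (principal_nontrivial nxy)).
  by apply: subset_trans DP2; apply: sub_radical; apply: Hyy; exact: nonzeroH.
have notP z : (H `\` Q) z -> (H `\` P) z by move=> [Hz nQz]; split=> // /PQ.
apply: nPy; apply: (primeNM pP (notP _ (primeN_M pQ (conj He nQe) Qbg))) => //.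
have -> : e * (b * g) * y = c * (b * g) * (g * y) by rewrite ce; ac.
have -> : c * (b * g) * (g * y) = c * ((b * g) * (g * y)) by ac.
apply: r_idealMr => //; first exact: DP.
by apply: HM; [case: Qbg|exact: Bg].
Qed.

Lemma primes_contain_of_principal :
  (forall I, principal_ideal H I -> nontrivial H I ->
    r_invertible H r (radical H I)) ->
  primes_contain_invertible_radical H r.
Proof.
move=> invR P [rP pP] ntP.
have [x Px nx] := (nontrivialP (r_ideal_s_ideal rP)).1 ntP.
have invJ := invR _ (principal_ideal_setmul (nonzeroH nx))
  (principal_nontrivial nx).
exists (radical H (setmul [set x] H)); split=> //.
  by split; [exact: invJ.1|exact: radical_idem].
by apply: radical_prime_sub => //; apply: principal_sub => //; case: pP.
Qed.

(** * Treed monoids and prime powers *)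

(** If [x] is in [N] but not in [P], then treedness forces [P] into each prime
    [Q] that is minimal over [x], which [prime_gap] excludes. *)
Lemma dim_one_of_treed : r_treed H r ->
  primes_contain_invertible_radical H r -> dim_one.
Proof.
move=> treed pcJ P N rpP [rN pN] ntP PN.
have [M maxM NM] := exists_r_max rN (prime_s_ideal1 pN).
have [rM pM] := r_max_prime maxM.
have PM := subset_trans PN NM.
apply/seteqP; split=> // x Nx; apply: contrapT => nPx.
have Hx := rN.1 _ Nx; have rx := r_ideal_principal Hx.
have [|Q minQ QM] := @exists_minimal_prime (setmul [set x] H) _ pM.
  by apply: principal_sub (NM _ Nx); case: pM.
have rpQ := minimal_prime_r_ideal rx minQ; have [[_ xQ] mini] := minQ.
have Qx := xQ _ (principal_self x).
have PQ : P `<=` Q.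
  by have [//|/(_ _ Qx)] := treed M maxM P Q (conj rpP PM) (conj rpQ QM).
have [J [[rJ radJ] invJ JP]] := pcJ P rpP ntP.
apply: nPx; rewrite (prime_gap rpQ Qx _ radJ invJ rpP JP PQ) // =>
  P1 [rP1 pP1] P1Q P1x.
by apply: mini => //; split=> //; apply: principal_sub => //; case: pP1.
Qed.

Lemma setprod_nseq_sub2 k P : r_ideal H r P ->
  setprod (nseq k.+2 P) `<=` setprod (nseq 2 P).
Proof.
move=> rP _ [x Px [y Py <-]]; exists x => //; exists y => //.
have Py' : P y by apply: (@setprod_nseqS k).
by exists y => //; exists 1; rewrite ?mulg1.
Qed.

(** A proper inclusion of primes [P] in [M] passes through the square of a prime
    [Q] with [Q <> Q^2].  Pick [x] in [Q] outside the square.  A prime strictly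
    inside [Q] lies in the square of a prime contained in [Q], so it misses [x];
    hence [prime_gap] applies to [Q] and [x]. *)
Lemma dim_one_of_prime_power : r_prime_power_condition H r ->
  primary_r_ideal_inclusive H r -> primes_contain_invertible_radical H r ->
    dim_one.
Proof.
move=> pp incl pcJ P M rpP rpM ntP PM; apply: contrapT => nPM.
have sq P1 P2 : prime_r_ideal H r P1 -> prime_r_ideal H r P2 ->
  P1 `<=` P2 -> P1 <> P2 ->
    exists Q, [/\ prime_r_ideal H r Q, P1 `<=` r (setprod (nseq 2 Q)),
      r (setprod (nseq 2 Q)) <> Q & Q `<=` P2].
  move=> rp1 rp2 P12 nP12.
  have P12' : P1 `<` P2 by split=> // P21; apply: nP12; apply/seteqP.
  have [I [priI P1I [IR nIR] RP2]] := incl _ _ rp1 rp2 P12'.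
  have rpQ := primary_radical_prime priI.
  have [k k0 IE] := pp I priI; set Q := radical H I in rpQ IE nIR RP2 IR *.
  have QH := rpQ.1.1.
  have QQ : setprod (nseq 2 Q) `<=` H by exact: setprod_nseq_sub.
  have rQ1 : r (setprod (nseq 1 Q)) = Q.
    by rewrite /= setmul1; exact: rpQ.1.2.
  exists Q; split=> //.
    case: k k0 IE => [//|[_|k _]] IE.
      by case: nIR; rewrite IE rQ1.
    apply: (subset_trans P1I); rewrite IE; apply: r_mono => //.
    exact: setprod_nseq_sub2 rpQ.1.
  move=> eQ; apply: nIR; rewrite IE.
  have QkH j : setprod (nseq j Q) `<=` H by exact: setprod_nseq_sub.
  have : forall j, Q `<=` r (setprod (nseq j.+1 Q)).
    elim=> [|j IHj]; first by rewrite rQ1.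
    rewrite -{1}eQ; apply: r_hull => //; first exact: r_idem.
    move=> _ [x Qx [_ [y Qy [_ -> <-]] <-]]; rewrite mulg1.
    apply: (r_transporter (QkH j.+1) (r_idem (QkH j.+2))) (IHj y Qy) => z Qz.
    by apply: sub_r; [exact: (QkH j.+2)|exists x => //; exists z].
  by case: k k0 {IE} => // k _.
have [Q [rpQ PQ nQ QM]] := sq _ _ rpP rpM PM nPM.
have [rQ pQ] := rpQ.
have QQH : setprod (nseq 2 Q) `<=` H by exact: setprod_nseq_sub rQ.1.
have QQQ : r (setprod (nseq 2 Q)) `<=` Q by apply: r_hull => //;
  exact: setprod_nseqS.
have [x Qx nQx] : exists2 x, Q x & ~ r (setprod (nseq 2 Q)) x.
  by apply: nsubset_witness => QQ; apply: nQ; apply/seteqP.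
have [J [[rJ radJ] invJ JP]] := pcJ P rpP ntP.
have PQ' := subset_trans PQ QQQ.
have ePQ : P = Q.
  apply: (prime_gap rpQ Qx _ radJ invJ rpP JP PQ') => P1 rpP1 P1Q P1x.
  apply: contrapT => nP1Q; have [Q' [rpQ' P1Q' _ Q'Q]] :=
    sq _ _ rpP1 rpQ P1Q nP1Q.
  apply: nQx; have : r (setprod (nseq 2 Q')) x by exact: P1Q'.
  apply: r_mono => // _ [y Qy [_ [z Qz [_ -> <-]] <-]].
  exists y; first exact: Q'Q.
  by exists (z * 1) => //; exists z; [exact: Q'Q|exists 1].
by apply: nQx; apply: PQ; rewrite ePQ.
Qed.

Lemma treed_of_dim_one : dim_one -> r_treed H r.
Proof.
move=> dim M maxM P Q [rpP PM] [rpQ QM]; have rpM := r_max_prime maxM.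
have [ntP|ntP] := pselect (nontrivial H P).
  by right; rewrite (dim P M rpP rpM ntP PM).
left; rewrite (trivial_s_ideal _ ntP); last exact: r_ideal_s_ideal rpP.1.
by apply: s_ideal_zeros; exact: r_ideal_s_ideal rpQ.1.
Qed.

(** * Discrete valuation monoids *)

Lemma sub_localization P : prime_s_ideal H P -> H `<=` localization H P.
Proof.
by move=> pP x Hx; exists x, 1; rewrite mulg1; split=> //;
  case: (prime_compl pP).
Qed.

Lemma localizationM P x y : prime_s_ideal H P -> localization H P x ->
  localization H P y -> localization H P (x * y).
Proof.
move=> pP [h [s [Hh Ps xs]]] [k [t [Hk Pt yt]]]; exists (h * k), (s * t).
by split; [exact: HM|exact: primeN_M|rewrite -xs -yt; ac].
Qed.

Lemma localization_inv P s t : prime_s_ideal H P -> (H `\` P) s -> s * t = 1 ->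
  localization H P t.
Proof. by move=> pP Ps st; exists 1, s; rewrite C st. Qed.

(** Localizing creates no zeros, which is why a nonzero element of a localization
    has a nonzero numerator. *)
Lemma zeros_localization P x s : prime_s_ideal H P -> localization H P x ->
  (H `\` P) s -> zeros H (x * s) -> zeros (localization H P) x.
Proof.
move=> pP Kx Ps [_ zxs]; split=> // w [h [t [Hh Pt wt]]].
have [Ht _] := Pt.
apply: (nonzeroI (nonzeroM (prime_nonzero pP Ps) (prime_nonzero pP Pt))).
have -> : s * t * (x * w) = (x * s) * (w * t) by ac.
by rewrite wt zxs // -(zxs t) //; ac.
Qed.

(** If [H] is not its quotient monoid, then some nonzero [s] is not a unit. *)
Lemma r_max_nontrivial M : H <> setT -> r_max H r M -> nontrivial H M.
Proof.
move=> HG maxM; have [rM pM] := r_max_prime maxM; apply: contrapT => ntM.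
have zM := trivial_s_ideal (r_ideal_s_ideal rM) ntM.
apply: HG; apply/seteqP; split=> // g _; have [h [s [Hh ns gs]]] := fraction g.
have rs := r_ideal_principal (nonzeroH ns).
have [/principalP[t Ht ts]|s1] := pselect (setmul [set s] H 1).
  have -> : g = h * t by rewrite -[g]mulg1 ts -gs; ac.
  exact: HM.
have [N maxN sN] := exists_r_max rs s1.
have [rN pN] := r_max_prime maxN.
have NM : N = M.
  apply: (proj2 maxM); first by case: maxN.
  by rewrite zM; apply: s_ideal_zeros; exact: r_ideal_s_ideal.
have : N s by apply: sN; exact: principal_self.
by rewrite NM zM; case: ns.
Qed.

(** An s-ideal of the localization that is not trivial is generated by the least
    power of a uniformizer that it contains. *)
Lemma almost_dedekind_of_dim_one : dim_one ->
  primes_contain_invertible_radical H r -> r_almost_dedekind H r.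
Proof.
move=> dim pcJ; have [HG|HG] := pselect (H = quotient H);
  [by left|right=> M maxM].
rewrite (quotient_monoid_frac quotG) in HG.
have rpM := r_max_prime maxM; have [rM pM] := rpM.
have [a ua] := exists_uniformizer dim pcJ rpM (r_max_nontrivial HG maxM).
have [Ma na _] := ua; have Ha := nonzeroH na.
set K := localization H M; have HK := sub_localization pM.
have KM x y : K x -> K y -> K (x * y) by exact: localizationM.
split.
  have [b ab] := nonzero_inv na => KE.
  have nKa : nonzero K a.
    split; first exact: HK.
    move=> [_ za]; case: (na) => _; apply; split=> // w Hw; apply: za;
      exact: HK.
  have : quotient K b by exists 1, a; split=> //; [exact: HK|rewrite C].
  rewrite -KE => -[h [s [Hh [Hs nMs] bs]]]; apply: nMs.
  have -> : s = a * h by rewrite -bs mulgA ab mul1g.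
  exact: r_idealMr.
move=> X [XK XE].
have XM x y : X x -> K y -> X (x * y) by move=> Xx Ky; rewrite XE; left;
  exists x => //; exists y.
have [Xz|nXz] := pselect (X `<=` zeros K).
  exists set0; split=> //; apply/seteqP; split=> [x /Xz|x [[? []]//|zx]];
    first by right.
  by rewrite XE; right.
have pow x : X x -> ~ zeros K x -> exists k t u, [/\ (H `\` M) t, (H `\` M) u,
    t * x = u * a ^+ k & X (a ^+ k)].
  move=> Xx nzx; have Kx := XK _ Xx; have [h [s [Hh Ms xs]]] := Kx.
  have nh : nonzero H h.
    by split=> // zh; apply: nzx; apply: (zeros_localization pM Kx Ms);
      rewrite xs.
  have [k [t [u [Mt Mu th]]]] := valuation dim rpM ua nh.
  exists k, (t * s), u; split=> //; first exact: primeN_M.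
    by rewrite -th -xs; ac.
  have [v uv] := nonzero_inv (prime_nonzero pM Mu).
  have -> : a ^+ k = x * (s * t * v).
    have -> : x * (s * t * v) = v * (t * (x * s)) by ac.
    by rewrite xs th mulgA (C v) uv mul1g.
  apply: XM => //; apply: KM; last exact: localization_inv Mu uv.
  by apply: HK; apply: HM; [case: Ms|case: Mt].
have [k Xk mink] : exists2 k, X (a ^+ k) & forall j, X (a ^+ j) -> (k <= j)%N.
  apply: least_nat; have [x Xx nzx] := nsubset_witness nXz.
  by have [k [? [? [_ _ _ Xk]]]] := pow x Xx nzx; exists k.
exists [set a ^+ k]; split; first by move=> _ ->; exact: XK.
  by move=> x y -> ->.
apply/seteqP; split=> x.
  move=> Xx; have [zx|nzx] := pselect (zeros K x); [by right|left].
  have [j [t [u [Mt [Hu _] tx Xj]]]] := pow x Xx nzx.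
  have [v tv] := nonzero_inv (prime_nonzero pM Mt).
  exists (a ^+ k) => //; exists (a ^+ (j - k) * u * v).
    apply: KM; last exact: localization_inv Mt tv.
    by apply: HK; apply: HM => //; exact: HX.
  have -> : a ^+ k * (a ^+ (j - k) * u * v) = v * (u * (a ^+ k * a ^+ (j - k)))
    by ac.
  by rewrite -expD subnKC ?mink // -tx mulgA (C v) tv mul1g.
move=> [[_ -> [w Kw <-]]|zx]; first exact: XM.
by rewrite XE; right.
Qed.

(** Let [p] and [m] generate the extensions of [P] and [M], and [p = m * k].  As
    the extension of [P] is prime, it contains [m] or [k].  In the first case [P]
    contains [M].  In the second, [k = p * l = m * k * l], so that [m] is a unit of
    the localization, which is absurd.  Fractions are written out, so that only
    the primeness of [P] itself is used. *)
Lemma dvm_prime_eq M P : prime_r_ideal H r M -> prime_r_ideal H r P ->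
  is_dvm (localization H M) -> nontrivial H P -> P `<=` M -> P = M.
Proof.
move=> [rM pM] [rP pP] [_ dvm] ntP PM; set K := localization H M in dvm *.
have HK := sub_localization pM.
have KM x y : K x -> K y -> K (x * y) by exact: localizationM.
have [x Px nx] := (nontrivialP (r_ideal_s_ideal rP)).1 ntP.
have HK1 : K 1 by exact: HK.
(* A generator [p] of the extension of [Q], with its inverse [c] in [G]. *)
have gen Q : r_ideal H r Q -> P `<=` Q -> Q `<=` M -> exists p c,
    [/\ exists2 l, K l & exists2 q, Q q & p = q * l, p * c = 1 &
        forall q l, Q q -> K l ->
          (exists2 l', K l' & q * l = p * l') \/ zeros K (q * l)].
  move=> rQ PQ QM; have QH := rQ.1.
  have QK : setmul Q K `<=` K by move=> _ [q Qq [k Kk <-]]; apply: KM => //;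
    apply: HK; exact: QH.
  have sQ : s_ideal K (setmul Q K).
    split=> //; apply/seteqP; split=> [y Qy|y].
      by left; exists y => //; exists 1; rewrite ?mulg1.
    move=> [[_ [q Qq [k Kk <-]] [l Kl <-]]|[Ky zy]].
      by exists q => //; exists (k * l); [exact: KM|rewrite mulgA].
    by exists x; [exact: PQ|exists y => //; rewrite C zy //; apply: HK;
      exact: nonzeroH].
  have [A [AK A1 QE]] := dvm _ sQ.
  have nzx : ~ zeros K x.
    move=> [_ zx]; case: nx => Hx; apply; split=> // w Hw; apply: zx; exact: HK.
  have : setmul Q K x by exists x; [exact: PQ|exists 1; rewrite ?mulg1].
  rewrite {1}QE => -[[p Ap [k Kk pk]]|//].
  have [y xy] := nonzero_inv nx; exists p, (k * y); split.
  - have : (setmul A K `|` zeros K) p.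
      by left; exists p => //; exists 1; rewrite ?mulg1.
    by rewrite -QE => -[q Qq [l Kl <-]]; exists l => //; exists q.
  - by rewrite mulgA pk.
  - move=> q l Qq Kl; have : setmul Q K (q * l) by exists q => //; exists l.
    rewrite QE => -[[p' Ap' [l' Kl' <-]]|]; last by right.
    by left; exists l' => //; rewrite (A1 _ _ Ap' Ap).
have unitN z c : z * c = 1 -> ~ zeros K z.
  move=> zc [_ zz]; apply: (prime_s_ideal1 pM); apply: PM;
    suff -> : 1 = x by [].
  have /(congr1 (mul c)) := zz x (HK _ (nonzeroH nx)).
  by rewrite mulgA (C c) zc mul1g.
have [p [c [[k3 Kk3 [p1 Pp1 pE]] pc genP]]] := gen P rP (fun x Px => Px) PM.
have [m [d [[k2 Kk2 [m1 Mm1 mE]] md genM]]] := gen M rM PM (fun x Mx => Mx).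
have [[k Kk pmk]|zp] : (exists2 l, K l & p = m * l) \/ zeros K p.
  by rewrite pE; apply: genM => //; exact: PM.
2: by case: (unitN _ _ pc zp).
have [h3 [s3 [Hh3 Ms3 ks3]]] := Kk3; have [Hs3 _] := Ms3.
have [h2 [s2 [Hh2 Ms2 ks2]]] := Kk2.
have [h [s [Hh Ms ks]]] := Kk.
have notP z : (H `\` M) z -> (H `\` P) z by move=> [Hz nz]; split=> // /PM.
have [Hs _] := Ms; have [Hs2 _] := Ms2.
(* The product [m * k = p] with its denominators cleared. *)
have Pprod : P (s3 * (m1 * h2 * h)).
  have -> : s3 * (m1 * h2 * h) = p1 * (h3 * (s2 * s)).
    rewrite -ks2 -ks -ks3.
    have -> : s3 * (m1 * (k2 * s2) * (k * s)) = s3 * ((m1 * k2) * k) * (s2 * s)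
      by ac.
    rewrite -mE -pmk pE; ac.
  by apply: r_idealMr => //; apply: HM => //; exact: HM.
have Hm1 := rM.1 _ Mm1.
have nPs3 : (H `\` P) s3 by apply: notP.
have Pmhh : P (m1 * h2 * h) by apply: (primeNM pP nPs3) => //;
  apply: HM => //; exact: HM.
have [Pmh|Ph] : P (m1 * h2) \/ P h.
- by case: pP => _ _; apply => //; exact: HM.
- apply/seteqP; split=> // y My; have Hy := rM.1 _ My.
  have := genM y 1 My HK1; rewrite mulg1 => -[[l Kl yml]|zy].
    have [hl [sl [Hhl [Hsl nMsl] lsl]]] := Kl.
    have nP2 : (H `\` P) (s2 * sl) by apply: primeN_M => //; apply: notP.
    apply: (primeNM pP nP2 Hy).
    have -> : s2 * sl * y = m1 * h2 * hl.
      by rewrite yml mE -ks2 -lsl; ac.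
    exact: r_idealMr.
  apply: s_ideal_zeros (r_ideal_s_ideal rP) _ _.
  by case: zy => _ zy; split=> // w Hw; apply: zy; exact: HK.
- have [y sy] := nonzero_inv (prime_nonzero pM Ms).
  have Ky := localization_inv pM Ms sy.
  have kE : k = h * y by rewrite -ks -mulgA sy mulg1.
  have [[l Kl kpl]|zk] := genP h y Ph Ky; last first.
    exfalso; apply: (unitN k (m * c)); last by rewrite kE.
    by rewrite -pc pmk; ac.
  have ml1 : m * l = 1.
    have : m * k * c = m * (p * l) * c by rewrite kE kpl.
    by rewrite -pmk pc => E; rewrite [RHS]E -[LHS]mulg1 -pc; ac.
  have [hl [sl [Hhl [Hsl nMsl] lsl]]] := Kl.
  exfalso; have [_] := primeN_M pM Ms2 (conj Hsl nMsl); apply.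
  have -> : s2 * sl = m1 * (h2 * hl).
    by rewrite -[s2 * sl]mul1g -ml1 mE -ks2 -lsl; ac.
  by apply: r_idealMr => //; exact: HM.
Qed.

(** * Factorization into radical ideals *)

Lemma r_setmulr X Y : X `<=` H -> Y `<=` H ->
  r (setmul X (r Y)) = r (setmul X Y).
Proof.
move=> XH YH; have rYH := r_sub YH; have XYH := setmul_sub XH YH.
apply/seteqP; split.
  apply: r_hull; [exact: setmul_sub|exact: r_idem|].
  by move=> _ [x Xx [y ry <-]]; apply: r_mul => //; exact: sub_r.
apply: r_mono; first exact: setmul_sub.
by move=> _ [x Xx [y Yy <-]]; exists x => //; exists y => //; exact: sub_r.
Qed.

(** A prime that contains an r-product contains a factor, and the factors of an
    invertible r-product are invertible. *)
Lemma invertible_factor_of_setprod P (s : seq (set G)) : prime_r_ideal H r P ->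
  (forall i, (i < size s)%N -> radical_r_ideal H r (nth set0 s i)) ->
  r_invertible H r (r (setprod s)) -> r (setprod s) `<=` P ->
  exists J, [/\ radical_r_ideal H r J, r_invertible H r J & J `<=` P].
Proof.
move=> [rP pP]; elim: s => [|X s IHs] sR invs sP.
  case: (prime_s_ideal1 pP); apply: sP; apply: sub_r => //=.
  by move=> _ ->.
have RX : radical_r_ideal H r X by exact: (sR 0%N).
have sR' i : (i < size s)%N ->
  radical_r_ideal H r (nth set0 s i) by move=> lti; exact: (sR i.+1).
have XH := RX.1.1.
have sH : setprod s `<=` H by apply: setprod_sub => i /sR'[[]].
have [XP|nXP] := pselect (X `<=` P).
  exists X; split=> //; rewrite -RX.1.2; exact: invertible_factor invs.
have [x Xx nPx] := nsubset_witness nXP.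
apply: IHs => //; first by move: invs => /=; rewrite setmulC;
  exact: invertible_factor.
apply: r_hull => // y sy; have Hy := sH _ sy.
apply: (primeNM pP (conj (XH _ Xx) nPx) Hy); apply: sP.
by apply: sub_r; [exact: setmul_sub|exists x => //; exists y].
Qed.

Lemma primes_contain_of_SP : r_SP_monoid H r ->
  primes_contain_invertible_radical H r.
Proof.
move=> SP P rpP ntP; have [rP pP] := rpP.
have [x Px nx] := (nontrivialP (r_ideal_s_ideal rP)).1 ntP.
have [s [sR xE]] := SP _ (r_ideal_principal (nonzeroH nx)).
apply: (invertible_factor_of_setprod rpP sR); rewrite -xE.
  exact: principal_invertible.
by apply: principal_sub => //; case: pP.
Qed.

Lemma dim_one_of_almost_dedekind : r_almost_dedekind H r -> dim_one.
Proof.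
move=> aD P Q rpP [rQ pQ] ntP PQ; have [rP pP] := rpP.
case: aD => [HG|dvm].
  have [x Px nx] := (nontrivialP (r_ideal_s_ideal rP)).1 ntP.
  have [y xy] := nonzero_inv nx; case: (prime_s_ideal1 pP).
  by rewrite -xy; apply: r_idealMr => //;
    rewrite HG (quotient_monoid_frac quotG).
have [M maxM QM] := exists_r_max rQ (prime_s_ideal1 pQ).
have rpM := r_max_prime maxM.
have PM := dvm_prime_eq rpM rpP (dvm M maxM) ntP (subset_trans PQ QM).
by apply/seteqP; split=> //; rewrite PM.
Qed.

(** The r-ideal that remains when one factor [radical H I] is split off from
    an invertible [I]; in dimension one this lowers each positive local exponent
    by one. *)
Definition radical_colon I : set G :=
  r (setmul (inverse_ideal H (radical H I)) I).

Lemma colon_sub J I : I `<=` J -> setmul (inverse_ideal H J) I `<=` H.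
Proof. by move=> IJ _ [g Jg [x Ix <-]]; apply: (inverse_idealM Jg);
  exact: IJ. Qed.

Lemma invertible_mul_colon J I : r_invertible H r J -> r_ideal H r I ->
  I `<=` J -> r (setmul J (r (setmul (inverse_ideal H J) I))) = I.
Proof.
move=> [rJ /esym JJ] rI IJ; have KH := colon_sub IJ.
rewrite r_setmulr //; last exact: rJ.1.
have JKH := setmul_sub rJ.1 KH.
apply/seteqP; split.
  apply: r_hull => // _ [j Jj [_ [g Jg [x Ix <-]] <-]].
  by rewrite mulgA; apply: r_idealMl => //; rewrite C;
    exact: (inverse_idealM Jg).
move=> x Ix; rewrite -[x]mulg1.
have J1 : r (setmul J (inverse_ideal H J)) 1 by rewrite -JJ.
apply: (r_transporter (@mul_inverse_sub J) (r_idem JKH)) J1 =>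
  _ [j Jj [g Jg <-]].
apply: sub_r => //; exists j => //; exists (g * x); last by ac.
by exists g => //; exists x.
Qed.

Section DimensionOne.
Hypotheses (dim : dim_one) (pcJ : primes_contain_invertible_radical H r).

Let radI I : r_invertible H r I -> nontrivial H I ->
  r_invertible H r (radical H I).
Proof.
move=> invI ntI; apply: radical_invertible_of_dim_one => //.
exact: invertible_finitely_generated.
Qed.

Lemma radical_colonP I : r_invertible H r I -> nontrivial H I ->
  [/\ r_invertible H r (radical_colon I), I `<=` radical_colon I &
      r (setmul (radical H I) (radical_colon I)) = I].
Proof.
move=> invI ntI; have invR := radI invI ntI; have rI := invI.1.
have IR : I `<=` radical H I by apply: sub_radical; exact: rI.1.
have KH := colon_sub IR; have rK := r_idem KH.
have E := invertible_mul_colon invR rI IR.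
split=> //; last first.
  move=> x Ix; apply: sub_r => //; exists 1; last by exists x; rewrite ?mul1g.
  by apply: inverse_idealP => y [Hy _]; rewrite mul1g.
rewrite /radical_colon -rK.2; apply: (@invertible_factor _ (radical H I)).
- exact: rK.1.
- exact: radical_sub.
- by rewrite setmulC E.
Qed.

(** The iterates increase.  If none contained [1], their union would be in one
    maximal [M]; each step splits off an ideal inside [M], so [I] would be, near
    [M], in each power of a uniformizer [a].  But a nonzero element of [I] has a
    finite exponent. *)
Lemma radical_colon_reaches_H I : r_invertible H r I -> nontrivial H I ->
  exists n, iter n radical_colon I = H.
Proof.
move=> invI ntI; pose K n := iter n radical_colon I.
have Kinv n : r_invertible H r (K n) /\ nontrivial H (K n).
  elim: n => [|n [invK ntK]] //=; have [? sub _] := radical_colonP invK ntK.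
  by split=> //; exact: nontrivial_sub sub.
have KS n : K n `<=` K n.+1 by have [invK ntK] := Kinv n;
  case: (radical_colonP invK ntK).
have Kmono n k : (n <= k)%N -> K n `<=` K k.
  by move/subnKC <-; elim: (k - n)%N => [|j IHj]; rewrite ?addn0 // addnS;
    exact: subset_trans (KS _).
pose U : set G := \bigcup_n K n.
have UH : U `<=` H by move=> x [n _ Knx]; apply: (Kinv n).1.1.1.
have [/(r_finitary UH)[s sU rs1]|U1] := pselect (r U 1).
  have [n sK] : exists n, [set` s] `<=` K n.
    elim: s sU {rs1} => [|x s IHs] sU; first by exists 0%N.
    have [|n sn] := IHs; first by move=> y /= ys; apply: sU;
      rewrite /= inE ys orbT.
    have [|m _ Kmx] := sU x; first by rewrite /= inE eqxx.
    exists (maxn n m) => y /=; rewrite inE => /orP[/eqP->|ys].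
      by apply: Kmono Kmx; exact: leq_maxr.
    by apply: (Kmono n); [exact: leq_maxl|exact: sn].
  exists n; have [[rK _] _] := Kinv n;
    apply: contrapT => /(r_ideal_proper rK); apply.
  by apply: r_hull rs1 => //; apply: subset_trans sU UH.
have [M maxM UM] := exists_r_max (r_idem UH) U1.
have KM n : K n `<=` M by move=> x Kx; apply: UM; apply: sub_r => //; exists n.
have rpM := r_max_prime maxM; have [rM pM] := rpM.
have ntM : nontrivial H M by exact: nontrivial_sub (KM 0%N).
have [a ua] := exists_uniformizer dim pcJ rpM ntM; have [Ma na satM] := ua.
have Ha := nonzeroH na.
have rsat n := saturation_r_ideal pM (r_ideal_principal (HX n Ha)).
have Isat n : forall m, K m `<=` saturation M (setmul [set a ^+ n] H).
  elim: n => [|n IHn] m.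
    move=> x Kx; apply: saturation_sub => //; first exact: r_ideal_principal.
    by apply/principalP; exists x; rewrite ?mul1g //; apply: rM.1; exact: KM Kx.
  have [invK ntK] := Kinv m; have [invK' _ KE] := radical_colonP invK ntK.
  rewrite -KE; apply: r_hull => //.
    by apply: setmul_sub; [exact: radical_sub|exact: invK'.1.1].
  move=> _ [x Rx [y Ky <-]].
  have Mx : M x by apply: (radical_prime_sub pM (KM m)).
  rewrite expS; exact: saturation_principalM pM (satM x Mx) (IHn m.+1 y Ky).
have [x Ix nx] := (nontrivialP (r_ideal_s_ideal invI.1)).1 ntI.
have [k [t [u [Mt Mu tx]]]] := valuation dim rpM ua nx.
have [_ [v [Hv nMv] /principalP[w Hw vx]]] := Isat k.+1 0%N x Ix.
have [_] := primeN_M pM (conj Hv nMv) Mu; case.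
have -> : v * u = a * (t * w).
  apply: (nonzeroI (nonzeroX k na)).
  have -> : a ^+ k * (v * u) = v * (u * a ^+ k) by ac.
  have -> : a ^+ k * (a * (t * w)) = t * (a * a ^+ k * w) by ac.
  by rewrite -tx -expS -vx; ac.
by apply: r_idealMr => //; apply: HM => //; case: Mt.
Qed.

(** At a maximal ideal that contains [I], the radicals of [I] and of [L] agree,
    so there it is right to divide by the radical [J] of [L], which is invertible.
    At one that contains [L] but not [I], the quotient has to be trivial; the
    intersection of [I] with [J] is [J] there, and dividing it by [J] leaves [H]. *)
Lemma radical_factor L I : r_invertible H r L -> nontrivial H L ->
  r_ideal H r I -> L `<=` I ->
  r (setmul (radical H I)
       (r (setmul (inverse_ideal H (radical H L)) (I `&` radical H L)))) = I.
Proof.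
move=> invL ntL rI LI; set J := radical H L.
have invJ : r_invertible H r J by exact: radI.
have rJ := invJ.1; have ntI := nontrivial_sub ntL LI.
have LJ : L `<=` J by apply: sub_radical; exact: invL.1.1.
have ntJ := nontrivial_sub ntL LJ;
  have radJ : radical H J = J by exact: radical_idem.
have KH : setmul (inverse_ideal H J) (I `&` J) `<=` H.
  by apply: colon_sub => x [].
set K := setmul _ _ in KH *; have RH := @radical_sub I.
have RKH := setmul_sub RH KH; rewrite r_setmulr //.
apply/seteqP; split.
  apply: r_hull => // _ [p Rp [_ [g Jg [q [Iq Jq] <-]] <-]].
  have Hgq : H (g * q) := inverse_idealM Jg Jq.
  have Hp := RH _ Rp.
  apply: local_global => //; first exact: HM.
  move=> M maxM; have rpM := r_max_prime maxM; have [rM pM] := rpM.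
  split; first exact: HM.
  have [IM|nIM] := pselect (I `<=` M); last first.
    have [t It nMt] := nsubset_witness nIM.
    by exists t; [split=> //; exact: rI.1|apply: r_idealMr => //; exact: HM].
  have Mp : M p by exact: (radical_prime_sub pM IM).
  have [u Mu] := local_radical dim rpM rJ ntJ Mp; rewrite radJ => Jup.
  exists u => //; have -> : u * (p * (g * q)) = (g * (u * p)) * q by ac.
  by apply: r_idealMl => //; exact: (inverse_idealM Jg).
move=> y Iy; have Hy := rI.1 _ Iy; have rRK := r_idem RKH.
apply: local_global => // M maxM; have rpM := r_max_prime maxM;
  have [rM pM] := rpM.
have [a [g [Ja na Jg Mag]]] := invertible_local invJ rpM.
have Jg' := inverse_idealP Jg; have Ha := nonzeroH na.
split=> //; have [IM|nIM] := pselect (I `<=` M); last first.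
  have [t It nMt] := nsubset_witness nIM.
  have Ht := rI.1 _ It.
  exists (t * t * (a * g)); first by do 2?[apply: primeN_M => //].
  have -> : t * t * (a * g) * y = (t * (g * (t * a))) * y by ac.
  apply: r_idealMr => //; apply: sub_r => //; exists t;
    first exact: sub_radical rI.1 _ It.
  exists (g * (t * a)) => //; exists g => //; exists (t * a) => //.
  by split; [exact: r_idealMr|exact: r_idealMl].
have JM : J `<=` M by apply: radical_prime_sub => //; exact: subset_trans IM.
have [t Mt] := local_radical dim rpM rJ ntJ (IM _ Iy); rewrite radJ => Jty.
have [u Mu Rua] := local_radical dim rpM rI ntI (JM _ Ja).
exists (u * t * (a * g)); first by do 2?[apply: primeN_M => //].
apply: sub_r => //; exists (u * a) => //; exists (g * (t * y)); last by ac.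
exists g => //; exists (t * y) => //; split=> //.
by apply: r_idealMl => //; case: Mt.
Qed.

(** A nontrivial [I] contains an invertible [L], for instance a principal ideal.
    Splitting off the radicals of [I] and of [L] in parallel keeps [L] inside [I],
    and after finitely many steps [L] has become [H]. *)
Lemma SP_of_dim_one : r_SP_monoid H r.
Proof.
have main n : forall L I, iter n radical_colon L = H -> r_invertible H r L ->
    nontrivial H L -> r_ideal H r I -> L `<=` I ->
    exists s : seq (set G),
      (forall i, (i < size s)%N -> radical_r_ideal H r (nth set0 s i)) /\
      I = r (setprod s).
  elim: n => [|n IHn] L I.
    move=> /= -> _ _ rI HI; exists [::]; split=> //=.
    have H1' : [set 1] `<=` H by move=> _ ->.
    apply/seteqP; split; last by apply: r_hull => // _ ->; exact: HI.
    move=> x /(rI.1) Hx; rewrite -[x]mul1g; apply: r_idealMr => //;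
      first exact: r_idem.
    exact: sub_r.
  rewrite iterSr => iterL invL ntL rI LI.
  have IE := radical_factor invL ntL rI LI.
  have [invK LK _] := radical_colonP invL ntL.
  set I' := r (setmul (inverse_ideal _ _) _) in IE.
  have KH : setmul (inverse_ideal H (radical H L)) (I `&` radical H L) `<=` H.
    by apply: colon_sub => x [].
  have [||s [sR I'E]] := IHn (radical_colon L) I' iterL invK (nontrivial_sub
    ntL LK).
  - exact: r_idem.
  - apply: r_mono => // _ [g Jg [x Lx <-]]; exists g => //; exists x => //.
    by split; [exact: LI|apply: sub_radical Lx; exact: invL.1.1].
  have sH : setprod s `<=` H by apply: setprod_sub => i /sR[[]].
  exists (radical H I :: s); split; last first.
    by rewrite -[LHS]IE I'E r_setmulr //; exact: radical_sub.
  case=> [_|i lti]; last exact: sR.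
  by split; [exact: radical_r_idealP|exact: radical_idem].
move=> I rI; have [ntI|ntI] := pselect (nontrivial H I); last first.
  exists [:: I]; split; last by rewrite /= setmul1 rI.2.
  case=> // _; split=> //; apply/seteqP; split; last by apply: sub_radical;
    exact: rI.1.
  move=> x [Hx [n _ Ixn]]; rewrite (trivial_s_ideal (r_ideal_s_ideal rI) ntI)
    in Ixn *.
  apply: contrapT => nzx; have [_ nzxn] :=
    nonzeroX n (conj Hx nzx : nonzero H x).
  by apply: nzxn.
have [x Ix nx] := (nontrivialP (r_ideal_s_ideal rI)).1 ntI.
have invx := principal_invertible nx; have ntx := principal_nontrivial nx.
have [n nE] := radical_colon_reaches_H invx ntx.
by apply: (main n _ I nE invx ntx rI); apply: principal_sub => //;
  exact: r_ideal_s_ideal.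
Qed.

End DimensionOne.
End IdealTheory.

Theorem theorem3p9 (G : monoidType) (H : set G) (r : set G -> set G)
    (monH : is_monoid H) (quotG : is_quotient_monoid H)
    (sysr : finitary_ideal_system H r) :
  [<-> (* 1 *) r_almost_dedekind H r /\ r_SP_monoid H r;
       (* 2 *) r_treed H r /\ primes_contain_invertible_radical H r;
       (* 3 *) [/\ r_prime_power_condition H r,
                   primary_r_ideal_inclusive H r &
                   primes_contain_invertible_radical H r];
       (* 4 *) forall I, r_finitely_generated H r I -> nontrivial H I ->
                 r_invertible H r (radical H I);
       (* 5 *) (forall I, r_finitely_generated H r I -> nontrivial H I ->
                  minimal_primes H I `<=` height_one_primes H) /\
               (forall I, principal_ideal H I -> nontrivial H I ->
                  r_invertible H r (radical H I))].
Proof.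
tfae.
- move=> [aD SP]; split; last exact: primes_contain_of_SP.
  by apply: treed_of_dim_one => //; exact: dim_one_of_almost_dedekind.
- move=> [treed pcJ]; have dim : dim_one H r by exact: dim_one_of_treed.
  split=> //; [exact: prime_power_of_dim_one|exact: inclusive_of_dim_one].
- move=> [pp incl pcJ]; have dim : dim_one H r by exact: dim_one_of_prime_power.
  exact: radical_invertible_of_dim_one.
- move=> invR; split; first exact: minimal_primes_height_one.
  move=> I pI ntI; apply: invR => //.
  have [h nh ->] := principal_idealE monH sysr pI ntI.
  exact: principal_finitely_generated.
- move=> [ht1 invR]; have dim : dim_one H r by exact: dim_one_of_height_one.
  have pcJ : primes_contain_invertible_radical H r.
    exact: primes_contain_of_principal.
  by split; [exact: almost_dedekind_of_dim_one|exact: SP_of_dim_one].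
Qed.
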